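(* Let $X \subset \mathbb{P}^N$ be a smooth projective variety over $\mathbb{C}$, and let $X^* \subset (\mathbb{P}^N)^*$ be its projective dual. For an integer $r$, denote by $\overline{X}^*_r$ the variety $$\overline{X}^*_r := \{ H^{\perp} \in X^* \ \text{such that}\ \dim \langle T_{(H \cap X)_{tan}} \rangle \geq r \}.$$ Then $\dim \overline{X}^*_r \leq N-r-1$.
   Context: For a hyperplane $H \subset \mathbb{P}^N$, $H^{\perp}$ denotes the corresponding point of the dual projective space $(\mathbb{P}^N)^*$. For smooth $X$, the conormal variety is $I_X = \mathbb{P}(N^*_{X/\mathbb{P}^N}(1)) \subset \mathbb{P}^N \times (\mathbb{P}^N)^*$, whose points are the pairs $(x,H^{\perp})$ with $x\in X$ and $H$ containing the embedded projective tangent space to $X$ at $x$. The projective dual $X^*$ is the image of $I_X$ in $(\mathbb{P}^N)^*$. For $H^{\perp}\in X^*$, the tangency scheme $(H\cap X)_{tan}$ of $H$ along $X$ is the scheme-theoretic fibre of $I_X \to X^*$ over $H^{\perp}$, viewed as a (possibly non-reduced) subscheme of $X \subset \mathbb{P}^N$. $\langle T_{(H \cap X)_{tan}} \rangle$ denotes the linear span in $\mathbb{P}^N$ of the union, over all points of the tangency scheme $(H \cap X)_{tan}$, of the embedded projective (Zariski) tangent spaces to $(H \cap X)_{tan}$. The $\dim$ of a linear span is its projective dimension. *)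

(* Defs.v *)
From HB Require Import structures.
From mathcomp Require Import all_boot all_order all_algebra.
From mathcomp Require Import boolp classical_sets reals topology_structure.
From mathcomp Require Import complex.
From mathcomp Require Import mpoly.
Set Implicit Arguments.
Unset Strict Implicit.
Unset Printing Implicit Defensive.
Import Order.TTheory GRing.Theory Num.Theory.
Local Open Scope classical_set_scope.
Local Open Scope ring_scope.

Section LinearSpan.
Variables (K : fieldType) (vT : vectType K).
Implicit Types (S : set vT) (W : {vspace vT}).

Definition is_linear_span S W : Prop :=
  (forall v, S v -> v \in W) /\
  (forall W', (forall v, S v -> v \in W') -> (W <= W')%VS).

Lemma linear_span_exists S : exists W, is_linear_span S W.
Proof.
pose P n := `[< exists s : seq vT, (forall v, v \in s -> S v) /\ \dim <<s>> = n >].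
have P0 : exists n, P n.
  exists 0%N; apply/asboolP; exists [::]; split => //.
  by rewrite span_nil dimv0.
have Pub n : P n -> (n <= \dim {:vT})%N.
  by move=> /asboolP[s [_ <-]]; exact: dimvS (subvf _).
case: (ex_maxnP P0 Pub) => m /asboolP[s [sS dims]] max_m.
exists <<s>>%VS; split=> [v Sv|W' SW']; last first.
  by apply/span_subvP => v /sS; exact: SW'.
have sub : (<<s>> <= <<v :: s>>)%VS.
  by apply: sub_span => u us; rewrite inE us orbT.
have : (\dim <<v :: s>> <= \dim <<s>>)%N.
  rewrite dims; apply: max_m; apply/asboolP; exists (v :: s); split => //.
  by move=> u; rewrite inE => /predU1P[->//|/sS].
move=> led; have /eqP -> : <<s>>%VS == <<v :: s>>%VS by rewrite eqEdim sub led.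
by rewrite memv_span // inE eqxx.
Qed.

Definition linear_span S : {vspace vT} := sval (cid (linear_span_exists S)).

End LinearSpan.

Section KrullDimension.
Variable T : topologicalType.
Implicit Types S Y : set T.

Definition irreducible Y : Prop :=
  Y !=set0 /\
  forall A B, closed A -> closed B -> Y `<=` A `|` B -> Y `<=` A \/ Y `<=` B.

Definition irreducible_chain S (n : nat) : Prop :=
  exists Y : nat -> set T,
    (forall i, (i <= n)%N ->
       irreducible (Y i) /\ exists A, closed A /\ Y i = A `&` S) /\
    (forall i, (i < n)%N -> Y i `<` Y i.+1).

(* Krull dimension of S in the induced topology.  The supremum of the lengths of chains is compared with an integer, so that
   the empty set has dimension -oo. *)
Definition dim_le S (d : int) : Prop :=
  forall n, irreducible_chain S n -> n%:Z <= d.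

Definition dim_eq S (d : nat) : Prop :=
  irreducible_chain S d /\ dim_le S d%:Z.

End KrullDimension.

(* The points of P^N are the lines through 0 in K^(N+1). *)
Record proj_space (K : closedFieldType) (N : nat) :=
  Proj { line :> {vspace 'rV[K]_N.+1}; _ : \dim line == 1%N }.

HB.instance Definition _ K N := [isSub for @line K N].
HB.instance Definition _ K N := [Choice of proj_space K N by <:].

Section Zariski.
Variables (K : closedFieldType) (N : nat).
Local Notation V := 'rV[K]_N.+1.
Local Notation P := (proj_space K N).
Implicit Types (F : {mpoly K[N.+1]}) (J : set {mpoly K[N.+1]}).
Implicit Types (x : P) (p v : V).

Definition zeros J : set P :=
  [set x | forall F p, J F -> p \in line x -> F.@[p 0] = 0].

Definition homogeneous J : Prop := forall F, J F -> exists d, F \is d.-homog.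

Definition zariski_open (U : set P) : Prop :=
  exists J, homogeneous J /\ U = ~` zeros J.

Lemma line_neq0 x : exists2 p, p \in line x & p != 0.
Proof.
exists (vpick (line x)); first exact: memv_pick.
by rewrite vpick0 -dimv_eq0; case: x => L /= /eqP ->.
Qed.

Lemma line_scale x p v :
  p \in line x -> p != 0 -> v \in line x -> exists c, v = c *: p.
Proof.
case: x => L /= /eqP dL pL p0 vL; apply/vlineP.
suff /eqP -> : <[p]>%VS == L by [].
by rewrite eqEdim -memvE pL dL dim_vline p0.
Qed.

Lemma homog_eval_scale d F c p :
  F \is d.-homog -> F.@[(c *: p) 0] = c ^+ d * F.@[p 0].
Proof.
move=> /dhomogP hF; rewrite !mevalE mulr_sumr big_seq [RHS]big_seq.
apply: eq_bigr => m /hF md; rewrite mulrCA; congr (_ * _).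
rewrite -md /= mdegE -prodrXr -big_split /=.
by apply: eq_bigr => i _; rewrite mxE exprMn.
Qed.

Lemma zariski_openT : zariski_open setT.
Proof.
exists [set 1]; split=> [F ->|]; first by exists 0%N; exact: dhomog1.
apply/seteqP; split=> // x _ /(_ 1 0 erefl (mem0v _)) /eqP.
by rewrite meval1 oner_eq0.
Qed.

Lemma zariski_openI : setI_closed zariski_open.
Proof.
move=> _ _ [J1 [h1 ->]] [J2 [h2 ->]].
exists [set F | exists F1 F2, [/\ J1 F1, J2 F2 & F = F1 * F2]]; split.
  move=> _ [F1 [F2 [/h1[d1 hd1] /h2[d2 hd2] ->]]].
  by exists (d1 + d2)%N; exact: dhomogM.
rewrite -setCU; congr (~` _); apply/seteqP; split=> x.
  case=> hx _ p [F1 [F2 [J1F J2F ->]]] px; rewrite mevalM.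
    by rewrite (hx F1) // mul0r.
  by rewrite (hx F2) // mulr0.
move=> hx; apply: contrapT => /not_orP[n1 n2].
have [p px p0] := line_neq0 x.
have ne J : homogeneous J -> ~ zeros J x -> exists2 F, J F & F.@[p 0] != 0.
  move=> hJ; apply: contra_notP => nF F v JF vx.
  have [c ->] := line_scale px p0 vx; have [d hd] := hJ _ JF.
  rewrite (homog_eval_scale _ _ hd); apply/eqP; rewrite mulf_eq0; apply/orP.
  by right; apply: contrapT => /negP F0; apply: nF; exists F.
have [F1 J1F F10] := ne _ h1 n1; have [F2 J2F F20] := ne _ h2 n2.
have /eqP := hx (F1 * F2) p (ex_intro _ F1 (ex_intro _ F2 (And3 J1F J2F erefl))) px.
by rewrite mevalM mulf_eq0 (negPf F10) (negPf F20).
Qed.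

Lemma zariski_open_bigU (I : Type) (f : I -> set P) :
  (forall i, zariski_open (f i)) -> zariski_open (\bigcup_i f i).
Proof.
move=> /choice[J hJ]; exists (\bigcup_i J i); split.
  by move=> F [i _ JF]; exact: (hJ i).1 JF.
apply/seteqP; split=> [x [i _]|x nx].
  by rewrite (hJ i).2 => nx hx; apply: nx => F p JF; apply: hx; exists i.
apply: contrapT => nU; apply: nx => F p [i _ JF] px.
apply: contrapT => nF; apply: nU; exists i => //.
by rewrite (hJ i).2 => hx; apply: nF; exact: hx.
Qed.

End Zariski.

HB.instance Definition _ K N :=
  isOpenTopological.Build (proj_space K N)
    (@zariski_openT K N) (@zariski_openI K N) (@zariski_open_bigU K N).

Section Duality.
Variables (K : closedFieldType) (N : nat).
Local Notation V := 'rV[K]_N.+1.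
Local Notation P := (proj_space K N).
Implicit Types (J : set {mpoly K[N.+1]}) (X : set P) (x h : P).

Definition vanishing_ideal X : set {mpoly K[N.+1]} :=
  [set F | forall x p, X x -> p \in line x -> F.@[p 0] = 0].

(* Embedded Zariski tangent space at x, as a linear subspace of K^(N+1), of the
   closed subscheme of P^N defined by the homogeneous ideal J.  The ideal need
   not be saturated nor radical. *)
Definition tangent_space J x : {vspace V} :=
  linear_span [set v : V | forall F p, J F -> p \in line x ->
    \sum_(i < N.+1) (F^`M(i)).@[p 0] * v 0 i = 0].

Definition smooth_variety X : Prop :=
  [/\ closed X, irreducible X &
      exists2 d, dim_eq X d &
        forall x, X x -> \dim (tangent_space (vanishing_ideal X) x) = d.+1].

(* A point h of P^N, read in the dual projective space, is the line of the
   linear forms a whose kernel is the hyperplane H with H^perp = h. *)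
Definition in_hyperplane h (W : {vspace V}) : Prop :=
  forall a v : V, a \in line h -> v \in W -> \sum_(i < N.+1) a 0 i * v 0 i = 0.

Definition conormal X : set (P * P) :=
  [set xh | X xh.1 /\
            in_hyperplane xh.2 (tangent_space (vanishing_ideal X) xh.1)].

Definition projective_dual X : set P := [set xh.2 | xh in conormal X].

(* Being a projective bundle over a smooth variety, the conormal variety is
   reduced: its bihomogeneous ideal in K[x_0, .., x_N, y_0, .., y_N] consists of
   all polynomials that vanish at its points. *)
Definition conormal_ideal X : set {mpoly K[N.+1 + N.+1]} :=
  [set G | forall x h (p a : V), conormal X (x, h) ->
    p \in line x -> a \in line h -> G.@[row_mx p a 0] = 0].

Definition specialize (a : V) (G : {mpoly K[N.+1 + N.+1]}) : {mpoly K[N.+1]} :=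
  G \mPo [tuple match split i with
                | inl j => 'X_j
                | inr j => (a 0 j)%:MP
                end | i < N.+1 + N.+1].

(* The ideal of the scheme-theoretic fibre over h of the second projection of
   the conormal variety, as a subscheme of P^N. *)
Definition tangency_ideal X h : set {mpoly K[N.+1]} :=
  [set F | exists a G, [/\ a \in line h, a != 0, conormal_ideal X G &
                           F = specialize a G]].

Definition tangency_span X h : {vspace V} :=
  linear_span [set v | exists2 x, zeros (tangency_ideal X h) x &
                                  v \in tangent_space (tangency_ideal X h) x].

Definition dual_stratum X (r : int) : set P :=
  [set h | projective_dual X h /\ r <= (\dim (tangency_span X h))%:Z - 1].

End Duality.

(* Main.v *)
Require Import Defs.
From mathcomp Require Import all_boot all_order all_algebra.
From mathcomp Require Import boolp classical_sets reals complex.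
From mathcomp Require Import topology_structure mpoly ring zify.
Set Implicit Arguments.
Unset Strict Implicit.
Unset Printing Implicit Defensive.
Import Order.TTheory GRing.Theory Num.Theory.
Local Open Scope classical_set_scope.
Local Open Scope ring_scope.

(** Let Y be an irreducible piece of the stratum, on which the tangency span has
    projective dimension at least r, and let a run over the cone of Y.

    The affine cone over the conormal variety is isotropic for the standard
    symplectic form of pairs (point, linear form).  Suppose that a moves in the
    cone of Y with velocity eta, that a point p of the tangency scheme of a moves
    along with it with velocity w, and that v is a tangent vector of that scheme
    at p.  Then (w, eta) and (v, 0) are both tangent to the conormal variety at
    (p, a), so their symplectic product, which is the pairing of eta with v,
    vanishes ([conormal_isotropic]).  Hence the whole tangency span is orthogonal
    to the velocities of a, and r + 1 plus the dimension of the cone of Y is at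
    most N + 1.

    The point p has to be followed while a moves, and it may be any point of the
    tangency scheme, however special.  Being special does no harm: choose, for
    each a, points p_1(a), p_2(a), .. with independent tangent vectors, in an
    arbitrary way.  In characteristic 0 arbitrary functions on an irreducible
    variety become differentiable, in the sense of derivations at a point, after
    restriction to a suitable dense subset: each coordinate of the p_j is adjoined to the ring of functions,
    and after shrinking the domain either it satisfies no algebraic relation, or
    it is a simple root of a relation of minimal degree; in both cases
    derivations at a point extend ([generic_adjoin]).  This is generic smoothness,
    stripped of the geometry of the total space.

    The dimension of Y enters through a chain Y_0 < .. < Y_n of irreducible
    subsets.  Polynomials b_i that vanish on one cone of the chain but not on the
    next are algebraically independent on the last cone, so there are derivations
    that take prescribed values on them ([chain_derivations]).  The velocities
    of a along the n + 1 dual derivations are linearly independent, which gives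
    n + r + 1 <= N, as [irreducible_chain_bound] states. *)

(** * Subalgebras of functions and derivations at a point *)

Section FunctionAlgebras.
Variables (K : fieldType) (T : Type).
Implicit Types (A : set (T -> K)) (M : set T) (D : (T -> K) -> K).
Implicit Types (f g z : T -> K) (P Q R : T -> {poly K}) (m t : T).

Definition vanishes f M := forall t, M t -> f t = 0.

Record subalgebra A : Prop := Subalgebra {
  subalgC : forall c, A (fun=> c);
  subalgD : forall f g, A f -> A g -> A (fun t => f t + g t);
  subalgM : forall f g, A f -> A g -> A (fun t => f t * g t) }.

Record domain_on A M : Prop := DomainOn {
  domain_neq0 : M !=set0;
  domain_mul : forall f g, A f -> A g -> vanishes (fun t => f t * g t) M ->
    vanishes f M \/ vanishes g M }.

(** Zariski density as seen by A: its functions cannot tell M' from M by where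
    they vanish. *)
Definition dense_in A M' M :=
  M' `<=` M /\ forall f, A f -> vanishes f M' -> vanishes f M.

(** A tangent vector at m of the variety M whose ring of functions is A.  It is a
    total map on functions, constrained on A only; the last clause makes it
    a derivation of the restriction of A to M. *)
Record point_derivation A M m D : Prop := PointDerivation {
  pderC : forall c, D (fun=> c) = 0;
  pderD : forall f g, A f -> A g -> D (fun t => f t + g t) = D f + D g;
  pderM : forall f g, A f -> A g ->
    D (fun t => f t * g t) = D f * g m + f m * D g;
  pder0 : forall f, A f -> vanishes f M -> D f = 0 }.

(** An element of A[X] is encoded by its evaluations, as a family of polynomials
    over K, since the functions on T need not form a nontrivial ring and
    A is only a subset. *)
Definition polyfam A k P :=
  (forall j, A (fun t => (P t)`_j)) /\ forall t, (size (P t) <= k)%N.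

Definition adjoin A z : set (T -> K) :=
  [set f | exists k P, polyfam A k P /\ forall t, f t = (P t).[z t]].

Lemma subalg_sum A (F : nat -> T -> K) n : subalgebra A ->
  (forall i, A (F i)) -> A (fun t => \sum_(i < n) F i t).
Proof.
move=> algA AF; elim: n => [|n IH].
  by under eq_fun do rewrite big_ord0; exact: (subalgC algA).
by under eq_fun do rewrite big_ord_recr; exact: (subalgD algA).
Qed.

Lemma pder_sum A M m D (F : nat -> T -> K) n : subalgebra A ->
  point_derivation A M m D -> (forall i, A (F i)) ->
  D (fun t => \sum_(i < n) F i t) = \sum_(i < n) D (F i).
Proof.
move=> algA derD AF; elim: n => [|n IH].
  by under eq_fun do rewrite big_ord0; rewrite big_ord0 (pderC derD).
under eq_fun do rewrite big_ord_recr; rewrite (pderD derD) ?IH ?big_ord_recr //.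
exact: (subalg_sum n algA AF).
Qed.

Lemma polyfamW A k l P : (k <= l)%N -> polyfam A k P -> polyfam A l P.
Proof. by move=> kl [AP sP]; split=> // t; exact: leq_trans (sP t) kl. Qed.

Lemma polyfamD A k P Q :
  subalgebra A -> polyfam A k P -> polyfam A k Q ->
  polyfam A k (fun t => P t + Q t).
Proof.
move=> algA [AP sP] [AQ sQ]; split=> [j|t].
  by under eq_fun do rewrite coefD; exact: subalgD.
by rewrite (leq_trans (size_polyD _ _)) // geq_max sP sQ.
Qed.

Lemma polyfamM A k l P Q : subalgebra A -> polyfam A k P -> polyfam A l Q ->
  polyfam A (k + l) (fun t => P t * Q t).
Proof.
move=> algA [AP sP] [AQ sQ]; split=> [j|t].
  under eq_fun do rewrite coefM.
  apply: (@subalg_sum _ (fun i t => (P t)`_i * (Q t)`_(j - i)%N)) => // i.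
  exact: subalgM.
apply: leq_trans (size_polyMleq _ _) _; apply: leq_trans (leq_pred _) _.
by rewrite leq_add.
Qed.

Lemma polyfamC A f : subalgebra A -> A f -> polyfam A 1 (fun t => (f t)%:P).
Proof.
move=> algA Af; split=> [[|j]|t]; last exact: size_polyC_leq1.
  by under eq_fun do rewrite coefC eqxx.
by under eq_fun do rewrite coefC; exact: (subalgC algA).
Qed.

Lemma polyfamXn A n : subalgebra A -> polyfam A n.+1 (fun=> 'X^n).
Proof.
by move=> algA; split=> [j|t]; [exact: (subalgC algA)|rewrite size_polyXn].
Qed.

Lemma polyfamN A k P :
  subalgebra A -> polyfam A k P -> polyfam A k (fun t => - P t).
Proof.
move=> algA [AP sP]; split=> [j|t]; last by rewrite size_polyN.
under eq_fun do rewrite coefN -mulN1r.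
by apply: subalgM => //; exact: (subalgC algA).
Qed.

Lemma polyfam_deriv A k P : subalgebra A -> polyfam A k.+1 P ->
  polyfam A k (fun t => (P t)^`()).
Proof.
move=> algA [AP sP]; split=> [j|t].
  under eq_fun do rewrite coef_deriv -mulr_natr.
  by apply: subalgM => //; exact: (subalgC algA).
have [->|nz] := eqVneq (P t) 0; first by rewrite deriv0 size_poly0.
by rewrite -ltnS (leq_trans (lt_size_deriv nz)).
Qed.

Lemma subalgebra_adjoin A z : subalgebra A -> subalgebra (adjoin A z).
Proof.
move=> algA; split.
- move=> c; exists 1%N, (fun=> c%:P); split; last by move=> t; rewrite hornerC.
  exact: (polyfamC algA (subalgC algA c)).
- move=> f g [k [P [FP fE]]] [l [Q [FQ gE]]].
  exists (maxn k l), (fun t => P t + Q t); split.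
    apply: polyfamD => //; first exact: polyfamW (leq_maxl k l) FP.
    exact: polyfamW (leq_maxr k l) FQ.
  by move=> t; rewrite hornerD fE gE.
- move=> f g [k [P [FP fE]]] [l [Q [FQ gE]]].
  exists (k + l)%N, (fun t => P t * Q t); split; first exact: polyfamM.
  by move=> t; rewrite hornerM fE gE.
Qed.

Lemma sub_adjoin A z : subalgebra A -> A `<=` adjoin A z.
Proof.
move=> algA f Af; exists 1%N, (fun t => (f t)%:P); split; first exact: polyfamC.
by move=> t; rewrite hornerC.
Qed.

Lemma mem_adjoin A z : subalgebra A -> adjoin A z z.
Proof.
move=> algA; exists 2%N, (fun=> 'X); split; last by move=> t; rewrite hornerX.
exact: (polyfamXn 1 algA).
Qed.

Section Extension.
Variables (A : set (T -> K)) (M : set T) (m : T) (D : (T -> K) -> K).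
Hypotheses (algA : subalgebra A) (derD : point_derivation A M m D).
Variables (z : T -> K) (theta : K).

(** [extend] is the only possible value at P(z) of a derivation that extends D and
    sends z to theta, by the Leibniz rule. *)
Definition dcoef k P : {poly K} := \poly_(j < k) D (fun t => (P t)`_j).

Definition extend k P : K := (dcoef k P).[z m] + (P m)^`().[z m] * theta.

Lemma coef_dcoef k P j : polyfam A k P ->
  (dcoef k P)`_j = D (fun t => (P t)`_j).
Proof.
move=> [AP sP]; rewrite coef_poly; case: ltnP => // kj.
under eq_fun do rewrite nth_default ?(leq_trans (sP _)) //.
by rewrite (pderC derD).
Qed.

Lemma extendW k l P : polyfam A k P -> polyfam A l P -> extend k P = extend l P.
Proof.
move=> Fk Fl; congr (_.[_] + _); apply/polyP => j.
by rewrite !coef_dcoef.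
Qed.

Lemma extendD k P Q : polyfam A k P -> polyfam A k Q ->
  extend k (fun t => P t + Q t) = extend k P + extend k Q.
Proof.
move=> FP FQ; rewrite /extend derivD hornerD mulrDl addrACA; congr (_ + _).
rewrite -hornerD; congr _.[_]; apply/polyP => j.
rewrite coefD !coef_dcoef //; last exact: polyfamD.
under eq_fun do rewrite coefD.
by case: FP FQ => [AP _] [AQ _]; rewrite (pderD derD).
Qed.

Lemma extendN k P : polyfam A k P -> extend k (fun t => - P t) = - extend k P.
Proof.
move=> FP; rewrite /extend derivN hornerN opprD mulNr; congr (_ + _).
rewrite -hornerN; congr _.[_]; apply/polyP => j.
rewrite coefN !coef_dcoef //; last exact: polyfamN.
under eq_fun do rewrite coefN -mulN1r.
case: FP => [AP _]; rewrite (pderM derD) //; last exact: (subalgC algA).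
by rewrite (pderC derD) mul0r add0r mulN1r.
Qed.

Lemma extendM k l P Q : polyfam A k P -> polyfam A l Q ->
  extend (k + l) (fun t => P t * Q t) =
  extend k P * (Q m).[z m] + (P m).[z m] * extend l Q.
Proof.
move=> FP FQ; rewrite /extend derivM hornerD !hornerM.
have -> : dcoef (k + l) (fun t => P t * Q t) =
    dcoef k P * Q m + P m * dcoef l Q.
  apply/polyP => j; rewrite coef_dcoef; last exact: polyfamM.
  under eq_fun do rewrite coefM.
  case: (FP) (FQ) => [AP _] [AQ _].
  rewrite (@pder_sum _ _ _ _ (fun i t => (P t)`_i * (Q t)`_(j - i)%N) _
    algA derD); last by move=> i; exact: subalgM.
  rewrite coefD !coefM -big_split; apply: eq_bigr => i _ /=.
  by rewrite (pderM derD) // !coef_dcoef.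
by rewrite hornerD !hornerM; ring.
Qed.

Lemma extendC f : A f -> extend 1 (fun t => (f t)%:P) = D f.
Proof.
move=> Af; rewrite /extend derivC horner0 mul0r addr0 /dcoef poly_def.
rewrite big_ord1 expr0 alg_polyC hornerC.
by under eq_fun do rewrite coefC.
Qed.

Lemma extendXn n : extend n.+1 (fun=> 'X^n) = (z m ^+ n.-1 *+ n) * theta.
Proof.
rewrite /extend derivXn hornerMn hornerXn.
suff -> : dcoef n.+1 (fun=> 'X^n) = 0 by rewrite horner0 add0r.
apply/polyP => j; rewrite coef_dcoef ?(pderC derD) ?coef0 //.
exact: polyfamXn.
Qed.

Lemma extend_zero k P : M m -> polyfam A k P -> (forall t, M t -> P t = 0) ->
  extend k P = 0.
Proof.
move=> Mm FP P0; rewrite /extend P0 // deriv0 horner0 mul0r addr0.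
suff -> : dcoef k P = 0 by rewrite horner0.
apply/polyP => j; rewrite coef_dcoef // coef0.
by apply: (pder0 derD) => [|t /P0 ->]; [exact: FP.1|rewrite coef0].
Qed.

(** The candidate value depends on the choice of P, not only on P(z); it descends
    to A[z], and kills the functions that vanish, exactly when it kills every P
    such that P(z) vanishes. *)
Lemma extend_derivation M' :
  (forall k P, polyfam A k P -> vanishes (fun t => (P t).[z t]) M' ->
     extend k P = 0) ->
  exists D', [/\ point_derivation (adjoin A z) M' m D',
                 forall f, A f -> D' f = D f & D' z = theta].
Proof.
move=> ext0.
have /choice[D' D'P] : forall f, exists d, adjoin A z f ->
    exists k P,
      [/\ polyfam A k P, forall t, f t = (P t).[z t] & d = extend k P].
  move=> f; have [[k [P [FP fE]]]|] := pselect (adjoin A z f); last by exists 0.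
  by exists (extend k P); exists k, P.
have D'E k P f :
    polyfam A k P -> (forall t, f t = (P t).[z t]) -> D' f = extend k P.
  move=> FP fE; have /D'P[l [Q [FQ fQ ->]]] : adjoin A z f by exists k, P.
  have FP' := polyfamW (leq_maxl k l) FP.
  have FQ' := polyfamW (leq_maxr k l) FQ.
  apply/eqP; rewrite -subr_eq0 (extendW FQ FQ') (extendW FP FP').
  rewrite -extendN // -extendD //; last exact: polyfamN.
  apply/eqP/ext0; first by apply: polyfamD => //; exact: polyfamN.
  by move=> t _; rewrite hornerD hornerN -fE -fQ subrr.
exists D'; split.
- split.
  + move=> c; rewrite (@D'E 1%N (fun=> c%:P)) ?extendC ?(pderC derD) //.
    * exact: (subalgC algA).
    * exact: (polyfamC algA (subalgC algA c)).
    * by move=> t; rewrite hornerC.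
  + move=> f g [k [P [FP fE]]] [l [Q [FQ gE]]].
    have FP' := polyfamW (leq_maxl k l) FP.
    have FQ' := polyfamW (leq_maxr k l) FQ.
    rewrite (D'E _ _ _ FP' fE) (D'E _ _ _ FQ' gE) -extendD //.
    apply: D'E; first exact: polyfamD.
    by move=> t; rewrite hornerD fE gE.
  + move=> f g [k [P [FP fE]]] [l [Q [FQ gE]]].
    rewrite (D'E _ _ _ FP fE) (D'E _ _ _ FQ gE) fE gE -extendM //.
    apply: D'E; first exact: polyfamM.
    by move=> t; rewrite hornerM fE gE.
  + move=> f [k [P [FP fE]]] f0; rewrite (D'E _ _ _ FP fE); apply: ext0 => //.
    by move=> t /f0; rewrite fE.
- move=> f Af; rewrite (@D'E 1%N (fun t => (f t)%:P)) ?extendC //.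
    exact: polyfamC.
  by move=> t; rewrite hornerC.
- rewrite (@D'E 2%N (fun=> 'X^1)) ?extendXn ?mulr1n ?mul1r //.
    exact: (polyfamXn 1 algA).
  by move=> t; rewrite hornerX.
Qed.

End Extension.

(** * Generic extension of derivations *)

Lemma dense_in_refl A M : dense_in A M M.
Proof. by split. Qed.

Lemma dense_in_trans A M1 M2 M3 :
  dense_in A M1 M2 -> dense_in A M2 M3 -> dense_in A M1 M3.
Proof.
move=> [s12 d12] [s23 d23]; split; first exact: subset_trans s12 s23.
by move=> f Af f0; apply: d23 => //; exact: d12.
Qed.

Lemma domain_dense A M M' :
  subalgebra A -> domain_on A M -> dense_in A M' M -> domain_on A M'.
Proof.
move=> algA [[t Mt] domA] [sM dM]; split.
  apply: contrapT => /set0P/negP; rewrite negbK => /eqP M'0.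
  have /(_ t Mt)/eqP : vanishes (fun=> 1) M; last by rewrite oner_eq0.
  by apply: dM; [exact: (subalgC algA)|rewrite M'0].
move=> f g Af Ag /(dM _ (subalgM algA Af Ag))/(domA _ _ Af Ag).
by case=> h0; [left|right] => u /sM/h0.
Qed.

(** An irreducible set covered by two subsets has one of them dense. *)
Lemma dense_split A M M1 M2 : subalgebra A -> domain_on A M ->
  M1 `<=` M -> M2 `<=` M -> M `<=` M1 `|` M2 ->
  dense_in A M1 M \/ dense_in A M2 M.
Proof.
move=> algA [_ domA] s1 s2 s12; apply: contrapT => /not_orP[n1 n2].
have wit M' : M' `<=` M -> ~ dense_in A M' M ->
    exists f, [/\ A f, vanishes f M' & ~ vanishes f M].
  move=> sM' nd; apply: contrapT => nf; apply: nd; split=> // f Af f0.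
  by apply: contrapT => fM; apply: nf; exists f.
have [f [Af f0 fM]] := wit _ s1 n1; have [g [Ag g0 gM]] := wit _ s2 n2.
case: (domA f g Af Ag) => // t /s12[/f0|/g0] ->; [exact: mul0r|exact: mulr0].
Qed.

Lemma dense_neq0 A M r : subalgebra A -> domain_on A M ->
  A r -> ~ vanishes r M -> dense_in A (M `&` [set t | r t != 0]) M.
Proof.
move=> algA [_ domA] Ar nr; split=> [t []//|f Af f0].
case: (domA f r Af Ar) => // t Mt.
have [->|r0] := eqVneq (r t) 0; first exact: mulr0.
by rewrite f0 ?mul0r.
Qed.

Section GenericStep.
Variables (A : set (T -> K)) (M : set T) (z : T -> K).
Hypotheses (algA : subalgebra A) (domA : domain_on A M).

(** The function z may be algebraic on some dense subset of M without being so on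
    M, so all dense subsets compete for the minimal degree of a relation. *)
Definition generic_relation k M' R :=
  [/\ dense_in A M' M, polyfam A k.+1 R,
      vanishes (fun t => (R t).[z t]) M' & ~ vanishes (fun t => (R t)`_k) M].

(** Below the minimal degree, a polynomial that kills z on a dense subset has its
    leading coefficient zero, then the next one, and so on. *)
Lemma low_degree_zero l P M' :
  (forall k R, (k < l)%N -> ~ generic_relation k M' R) -> dense_in A M' M ->
  polyfam A l P -> vanishes (fun t => (P t).[z t]) M' ->
  forall t, M t -> P t = 0.
Proof.
move=> norel dM'; elim: l P norel => [|l IH] P norel [AP sP] P0 t Mt.
  by apply/eqP; rewrite -size_poly_leq0.
have lead0 : vanishes (fun t => (P t)`_l) M.
  by apply: contrapT => nl; apply: (norel l P).
have take_eq u : M u -> take_poly l (P u) = P u.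
  move=> Mu; apply/polyP => j; rewrite coef_take_poly; case: ltnP => //.
  rewrite leq_eqVlt => /predU1P[<-|lj]; first by rewrite lead0.
  by rewrite nth_default // (leq_trans (sP u)).
rewrite -(take_eq t Mt); apply: (IH (fun u => take_poly l (P u))) => //.
- by move=> k R kl; apply: norel; exact: ltnW.
- split=> [j|u]; last exact: size_take_poly.
  under eq_fun do rewrite coef_take_poly.
  by case: ltnP => // _; exact: (subalgC algA).
- by move=> u Mu; rewrite take_eq; [exact: P0|exact: dM'.1].
Qed.

(** One step of the pseudo-division of P by R: the terms of degree l cancel, and
    no division by the leading coefficient of R is needed. *)
Definition pseudo_reduce k l P R t :=
  ((R t)`_k)%:P * P t - ((P t)`_l)%:P * 'X^(l - k) * R t.

Lemma polyfam_pseudo_reduce k l P R : (k <= l)%N ->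
  polyfam A l.+1 P -> polyfam A k.+1 R ->
  polyfam A l (pseudo_reduce k l P R).
Proof.
move=> kl FP FR; have [AP sP] := FP; have [AR sR] := FR; split=> [j|t].
  have [Bj _] := polyfamM algA (polyfamC algA (AR k)) FP.
  have [Cj _] := polyfamN algA (polyfamM algA
    (polyfamM algA (polyfamC algA (AP l)) (polyfamXn (l - k) algA)) FR).
  by under eq_fun do rewrite coefD; exact: subalgD.
apply/leq_sizeP => j; rewrite leq_eqVlt coefB -mulrA !coefCM coefXnM.
move=> /predU1P[<-|lj].
  by rewrite ltnNge leq_subr /= subKn // mulrC subrr.
rewrite (nth_default _ (leq_trans (sP t) lj)) mulr0 sub0r.
have -> : (j < l - k)%N = false by lia.
have /(leq_trans (sR t)) sRj : (k < j - (l - k))%N by lia.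
by rewrite [(R t)`__]nth_default // mulr0 oppr0.
Qed.

Lemma horner_pseudo_reduce k l P R t : (P t).[z t] = 0 -> (R t).[z t] = 0 ->
  (pseudo_reduce k l P R t).[z t] = 0.
Proof. by rewrite hornerD hornerN !hornerM => -> ->; rewrite !mulr0 subrr. Qed.

Hypothesis char0 : [pchar K] =i pred0.

(** The points where the derivative of a minimal relation vanishes at z are not
    dense, because there the derivative would be a relation of smaller degree:
    in characteristic 0 its leading coefficient is k times that of R.  Hence
    z is a simple root on a dense subset. *)
Lemma minimal_relation :
  (exists k M' R, generic_relation k M' R) ->
  exists k M' R, [/\ dense_in A M' M, polyfam A k.+1 R,
    forall t, M' t -> (R t)`_k != 0 /\ (R t)^`().[z t] != 0,
    forall t, M' t -> (R t).[z t] = 0 &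
    forall j M'' Q, (j < k)%N -> ~ generic_relation j M'' Q].
Proof.
move=> ex_rel.
have ex_rel' : exists k, `[< exists M' R, generic_relation k M' R >].
  by case: ex_rel => k kP; exists k; apply/asboolP.
case: (ex_minnP ex_rel') => k /asboolP[M1 [R [dM1 FR R0 rM]]] min_k.
have norel j M'' Q : (j < k)%N -> ~ generic_relation j M'' Q.
  move=> jk rel; suff /min_k : `[< exists M' R, generic_relation j M' R >] by lia.
  by apply/asboolP; exists M'', Q.
have [AR sR] := FR.
have k_gt0 : (0 < k)%N.
  rewrite lt0n; apply/eqP => k0; apply: rM; apply: dM1.2 => // t /R0.
  rewrite (size1_polyC (leq_trans (sR t) _)) ?k0 // hornerC.
  by rewrite coefC eqxx.
have domM1 := domain_dense algA domA dM1.
have dM2 : dense_in A (M1 `&` [set t | (R t)`_k != 0]) M1.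
  by apply: dense_neq0 => // r0; apply: rM; exact: dM1.2.
have domM2 := domain_dense algA domM1 dM2.
set M2 := _ `&` _ in dM2 domM2.
have [] := @dense_split A M2 (M2 `&` [set t | (R t)^`().[z t] != 0])
    (M2 `&` [set t | (R t)^`().[z t] = 0]) algA domM2.
- by move=> t [].
- by move=> t [].
- by move=> t Mt; have [e|e] := eqVneq (R t)^`().[z t] 0; [right|left].
- move=> dM3; exists k, (M2 `&` [set t | (R t)^`().[z t] != 0]), R; split=> //.
  + exact: dense_in_trans dM3 (dense_in_trans dM2 dM1).
  + by move=> t [[_ /= ?] /= ?].
  + by move=> t [[/R0]].
- move=> dM3; case: rM => t Mt.
  have dM := dense_in_trans dM3 (dense_in_trans dM2 dM1).
  have FR' : polyfam A k (fun t => (R t)^`()) by exact: polyfam_deriv.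
  have R'0 := low_degree_zero (fun j Q jk => @norel j _ Q jk) dM FR' _ Mt.
  have /(congr1 (fun p : {poly K} => p`_k.-1)) := R'0 (fun u Mu => Mu.2).
  rewrite coef_deriv coef0 prednK // -mulr_natr => /eqP.
  rewrite mulf_eq0 ((pcharf0P K).1 char0) -[_ == 0%N]negbK -lt0n k_gt0 orbF.
  by move=> /eqP.
Qed.

(* core *)
(** For the minimal relation R, pseudo-division by R reduces every polynomial that
    kills z to one of lower degree, hence to 0.  So R alone decides which
    P(z) vanish and which theta is admissible: theta solves the equation obtained
    by differentiating R(z) = 0, and R'(z) is invertible.  The second clause,
    that vanishing on a dense subset suffices, is what keeps A[z] a domain. *)
Lemma generic_fiber : exists M', [/\ dense_in A M' M,
  forall M'' k P, dense_in A M'' M' -> polyfam A k P ->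
    vanishes (fun t => (P t).[z t]) M'' -> vanishes (fun t => (P t).[z t]) M' &
  forall m D, M' m -> point_derivation A M' m D -> exists theta,
    forall k P, polyfam A k P -> vanishes (fun t => (P t).[z t]) M' ->
    extend m D z theta k P = 0].
Proof.
have [/minimal_relation|norel] :=
  pselect (exists k M' R, generic_relation k M' R); last first.
  exists M; have low k P M' : dense_in A M' M -> polyfam A k P ->
      vanishes (fun t => (P t).[z t]) M' -> forall t, M t -> P t = 0.
    by apply: low_degree_zero => j R _ rel; apply: norel; exists j, M', R.
  split=> [|M' k P dM' FP P0 t Mt|m D Mm derD].
  - exact: dense_in_refl.
  - by rewrite (low k P M') ?horner0.
  - exists 0 => k P FP P0; apply: (extend_zero derD) => //.
    exact: (low k P M (dense_in_refl A M) FP P0).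
move=> [k [M1 [R [dM1 FR R_neq0 R0 norel]]]].
exists M1; split=> // [M' l P dM' FP P0|m D Mm derD].
  have dM := dense_in_trans dM' dM1.
  elim: l P FP P0 => [|l IH] P FP P0 t M1t.
    by have [_ /(_ t)] := FP; rewrite size_poly_leq0 => /eqP ->; rewrite horner0.
  have [kl|lk] := leqP k l; last first.
    suff -> : P t = 0 by rewrite horner0.
    apply: (low_degree_zero _ dM FP P0) => [j Q jl|]; last exact: dM1.1.
    by apply: norel; lia.
  have red0 : vanishes (fun u => (pseudo_reduce k l P R u).[z u]) M'.
    by move=> u Mu; apply: horner_pseudo_reduce; [exact: P0|exact/R0/dM'.1].
  have [rt _] := R_neq0 t M1t.
  have := IH _ (polyfam_pseudo_reduce kl FP FR) red0 t M1t.
  rewrite /pseudo_reduce hornerD hornerN !hornerM R0 // mulr0 subr0 hornerC.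
  move=> /eqP; by rewrite mulf_eq0 (negPf rt) => /eqP.
have [rm R'm] := R_neq0 m Mm.
exists (- ((dcoef D k.+1 R).[z m] / (R m)^`().[z m])).
set theta := - _.
have ext_R : extend m D z theta k.+1 R = 0.
  by rewrite /extend /theta mulrN mulrCA divff // mulr1 subrr.
elim=> [|l IH] P FP P0.
  apply: (extend_zero derD) => // t _.
  by have [_ /(_ t)] := FP; rewrite size_poly_leq0 => /eqP.
have [kl|lk] := leqP k l; last first.
  apply: (extend_zero derD) => // t Mt.
  apply: (low_degree_zero _ dM1 FP P0) => [j Q jl|]; last exact: dM1.1.
  by apply: norel; lia.
have FR1 := polyfam_pseudo_reduce kl FP FR.
(* pseudo_reduce is spelled as a difference of two products, whose formal size
   bounds n1 and n2 are larger than l; extend does not depend on the bound. *)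
have {IH} := IH _ FR1 (fun u Mu => horner_pseudo_reduce k l (P0 u Mu) (R0 u Mu)).
have [AR _] := FR; have [AP _] := FP.
have Fr := polyfamC algA (AR k).
have Fp := polyfamM algA (polyfamC algA (AP l)) (polyfamXn (l - k) algA).
have F1 := polyfamM algA Fr FP; have F2 := polyfamM algA Fp FR.
set n1 := (1 + l.+1)%N in F1; set n2 := (_ + k.+1)%N in F2.
have F1' := polyfamW (leq_maxl n1 n2) F1.
have F2' := polyfamW (leq_maxr n1 n2) F2.
have FR1' : polyfam A (maxn n1 n2) (pseudo_reduce k l P R).
  by apply: polyfamW FR1; rewrite /n1; lia.
rewrite (extendW derD _ _ FR1 FR1') /pseudo_reduce.
rewrite (extendD algA derD) //; last exact: polyfamN.
rewrite (extendN algA derD) // -(extendW derD _ _ F1 F1').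
rewrite -(extendW derD _ _ F2 F2') (extendM algA derD _ _ Fr FP).
rewrite (extendM algA derD _ _ Fp FR) ext_R R0 // P0 // hornerC.
rewrite !(mulr0, add0r, subr0) => /eqP.
by rewrite mulf_eq0 (negPf rm) => /eqP.
Qed.

(** An arbitrary function z is generically differentiable: derivations of A at
    a point of M' extend to A[z]. *)
Lemma generic_adjoin : exists M', [/\ dense_in A M' M,
  domain_on (adjoin A z) M' &
  forall m D, M' m -> point_derivation A M' m D -> exists D',
    point_derivation (adjoin A z) M' m D' /\ forall f, A f -> D' f = D f].
Proof.
have [M' [dM' gen der]] := generic_fiber; exists M'; split=> //.
  have domM' := domain_dense algA domA dM'.
  split; first exact: domain_neq0 domM'.
  move=> f g [k [P [FP fE]]] [l [Q [FQ gE]]] fg0.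
  have [] := @dense_split A M' (M' `&` [set t | f t = 0])
    (M' `&` [set t | g t = 0]) algA domM'.
  - by move=> t [].
  - by move=> t [].
  - move=> t Mt; have /eqP := fg0 t Mt; rewrite mulf_eq0.
    by move=> /orP[/eqP|/eqP]; [left|right].
  - move=> dM; left=> t Mt; rewrite fE; apply: (gen _ _ _ dM FP) => // u [_].
    by rewrite -fE.
  - move=> dM; right=> t Mt; rewrite gE; apply: (gen _ _ _ dM FQ) => // u [_].
    by rewrite -gE.
move=> m D Mm derD; have [theta ext0] := der m D Mm derD.
by have [D' [derD' DD' _]] := extend_derivation algA derD ext0; exists D'.
Qed.

End GenericStep.

(** Each adjunction shrinks the domain.  This is harmless for the earlier ones,
    since the smaller set is dense for the larger algebra, so the same functions
    vanish on it. *)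
Lemma generic_adjoin_seq (I : eqType) (z : I -> T -> K) (s : seq I) A M :
  [pchar K] =i pred0 -> subalgebra A -> domain_on A M ->
  exists A' M', [/\ subalgebra A' /\ A `<=` A', forall i, i \in s -> A' (z i),
    dense_in A M' M, M' !=set0 &
    forall m D, M' m -> point_derivation A M' m D -> exists D',
      point_derivation A' M' m D' /\ forall f, A f -> D' f = D f].
Proof.
move=> char0; elim: s A M => [|i s IH] A M algA domA.
  exists A, M; split=> //; [by split|exact: dense_in_refl|exact: domain_neq0 domA|].
  by move=> m D _ derD; exists D.
have [M1 [dM1 domA1 der1]] := generic_adjoin (z i) algA domA char0.
have AA1 := sub_adjoin (z i) algA.
have [A' [M' [[algA' A1A'] zA' dM' M'0 der']]] :=
  IH _ _ (subalgebra_adjoin (z i) algA) domA1.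
have dM'1 : dense_in A M' M1.
  by split; [exact: dM'.1|move=> f /AA1; exact: dM'.2].
exists A', M'; split=> //.
- by split=> //; exact: subset_trans AA1 A1A'.
- by move=> j; rewrite inE => /predU1P[->|/zA' //]; exact/A1A'/mem_adjoin.
- exact: dense_in_trans dM'1 dM1.
move=> m D M'm derD.
have [|D1 [derD1 DD1]] := der1 m D (dM'.1 _ M'm).
  split; [exact: pderC derD|exact: pderD derD|exact: pderM derD|].
  by move=> f Af f0; apply: (pder0 derD) => // t /dM'.1/f0.
have [|D' [derD' D1D']] := der' m D1 M'm.
  split; [exact: pderC derD1|exact: pderD derD1|exact: pderM derD1|].
  by move=> f Af f0; apply: (pder0 derD1) => //; exact: dM'.2.
by exists D'; split=> // f Af; rewrite D1D' ?DD1 //; exact: AA1.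
Qed.

Lemma subalgX A f n : subalgebra A -> A f -> A (fun t => f t ^+ n).
Proof.
move=> algA Af; elim: n => [|n IH].
  by under eq_fun do rewrite expr0; exact: (subalgC algA).
by under eq_fun do rewrite exprS; exact: subalgM.
Qed.

Lemma adjoin_subset A B z : subalgebra B -> A `<=` B -> B z -> adjoin A z `<=` B.
Proof.
move=> algB AB Bz f [k [P [[AP sP] fE]]].
have -> : f = (fun t => \sum_(j < k) (P t)`_j * z t ^+ j).
  by apply/funext => t; rewrite fE (horner_coef_wide _ (sP t)).
apply: (@subalg_sum _ (fun j t => (P t)`_j * z t ^+ j)) => // j.
by apply: subalgM => //; [exact/AB|exact: subalgX].
Qed.

(** Along a chain of irreducible sets, separating functions are algebraically
    independent on the last one: a relation P(b_l) = 0 over the algebra A generated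
    by the earlier functions becomes P(0) = 0 on S_l, where b_l vanishes; the
    functions of A are determined by their values there, so P is divisible by X,
    and b_l cancels since it is not 0 on S_(l+1).  Derivations at a point can thus
    be prescribed freely on the b_i. *)
Lemma chain_derivations B (S : nat -> set T) (b : nat -> T -> K) n :
  subalgebra B -> (forall i, (i <= n)%N -> domain_on B (S i)) ->
  (forall i, (i < n)%N -> S i `<=` S i.+1) ->
  (forall i, (i < n)%N ->
     [/\ B (b i), vanishes (b i) (S i) & ~ vanishes (b i) (S i.+1)]) ->
  exists A, [/\ subalgebra A, A `<=` B &
    forall m (theta : nat -> K), S n m -> exists D,
      point_derivation A (S n) m D /\
      forall i, (i < n)%N -> A (b i) /\ D (b i) = theta i].
Proof.
move=> algB domB Smono bP.
have subS i : (i <= n)%N -> S i `<=` S n.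
  move=> le_in; rewrite -(subnKC le_in).
  have : (i + (n - i) <= n)%N by rewrite subnKC.
  elim: (n - i)%N => [|d IH] le; first by rewrite addn0.
  rewrite addnS in le *; apply: subset_trans (IH (ltnW le)) _; exact: Smono.
suff /(_ n (leqnn n))[A [algA AB _ derA]] : forall l, (l <= n)%N ->
  exists A, [/\ subalgebra A, A `<=` B,
    forall f, A f -> vanishes f (S l) -> vanishes f (S n) &
    forall m (theta : nat -> K), S n m -> exists D,
      point_derivation A (S n) m D /\
      forall i, (i < l)%N -> A (b i) /\ D (b i) = theta i].
  by exists A.
elim=> [|l IH] ln.
  exists [set f | exists c, f = (fun=> c)]; split.
  - split=> [c|f g [c ->] [d ->]|f g [c ->] [d ->]]; first by exists c.
      by exists (c + d).
    by exists (c * d).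
  - by move=> f [c ->]; exact: (subalgC algB).
  - move=> f [c ->] c0 t _; have [u Su] := domain_neq0 (domB 0%N ln).
    exact: (c0 u Su).
  - move=> m theta _; exists (fun=> 0); split=> //; split=> //.
      by move=> *; rewrite addr0.
    by move=> *; rewrite mulr0 mul0r addr0.
have [A [algA AB injA derA]] := IH (ltnW ln).
have [Bb b0 bn0] := bP l ln.
(* algebraic independence of b_l over A, by removing a factor X at each step *)
have low k P : polyfam A k P -> vanishes (fun t => (P t).[b l t]) (S l.+1) ->
    forall t, S n t -> P t = 0.
  elim: k P => [|k IHk] P [AP sP] P0 t St.
    by apply/eqP; rewrite -size_poly_leq0.
  have coef0 : vanishes (fun t => (P t)`_0) (S n).
    apply: injA => // u Su; have := P0 u (Smono _ ln _ Su).
    by rewrite b0 // horner_coef0.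
  have dropE u : S n u -> P u = drop_poly 1 (P u) * 'X.
    move=> Su; apply/polyP => -[|j]; rewrite coefMX ?coef0 //=.
    by rewrite coef_drop_poly addn1.
  have Fdrop : polyfam A k (fun u => drop_poly 1 (P u)).
    split=> [j|u]; first by under eq_fun do rewrite coef_drop_poly.
    by rewrite size_drop_poly leq_subLR.
  have prod0 : vanishes (fun u => (drop_poly 1 (P u)).[b l u] * b l u) (S l.+1).
    move=> u Su; rewrite -[X in _ * X]hornerX -hornerM -dropE ?P0 //.
    exact: subS Su.
  rewrite dropE // (IHk _ Fdrop) ?mul0r //.
  have [] // := domain_mul (domB l.+1 ln) _ Bb prod0.
  by apply: (adjoin_subset algB AB Bb); exists k, (fun u => drop_poly 1 (P u)).
exists (adjoin A (b l)); split.
- exact: subalgebra_adjoin.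
- exact: adjoin_subset.
- move=> f [k [P [FP fE]]] f0 t St; rewrite fE (low k P) ?horner0 //.
  by move=> u Su; rewrite -fE f0.
- move=> m theta Sm; have [D [derD Db]] := derA m theta Sm.
  have [|D' [derD' DD' D'b]] :=
    @extend_derivation _ _ _ _ algA derD (b l) (theta l) (S n).
    move=> k P FP P0; apply: (extend_zero derD) => //; apply: (low _ _ FP).
    by move=> u Su; apply: P0; exact: subS Su.
  exists D'; split=> // i; rewrite ltnS leq_eqVlt => /predU1P[->|il].
    by split=> //; exact: mem_adjoin.
  have [Ab <-] := Db i il; split; first exact: sub_adjoin.
  exact: DD'.
Qed.
End FunctionAlgebras.

(** * Row vectors, pairings and linear spans *)

Section LinearAlgebra.
Variables (K : fieldType) (n : nat).
Implicit Types (a v w : 'rV[K]_n) (S : set 'rV[K]_n).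

Definition dot v w : K := \sum_(i < n) v 0 i * w 0 i.

Lemma dotC v w : dot v w = dot w v.
Proof. by apply: eq_bigr => i _; rewrite mulrC. Qed.

Lemma dot_mulmx v w : (v *m w^T) 0 0 = dot v w.
Proof. by rewrite mxE; apply: eq_bigr => j _; rewrite mxE. Qed.

Lemma mul_trmx_eq0 k (B : 'M[K]_(k, n)) v :
  (forall i, dot (row i B) v = 0) <-> v *m B^T = 0.
Proof.
have eqv i : (v *m B^T) 0 i = dot (row i B) v.
  by rewrite !mxE; apply: eq_bigr => j _; rewrite !mxE mulrC.
split=> [v0|v0 i]; first by apply/rowP => i; rewrite eqv v0 mxE.
by rewrite -eqv v0 mxE.
Qed.

Lemma dot_submx k (B : 'M[K]_(k, n)) v w : v *m B^T = 0 -> (w <= B)%MS ->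
  dot w v = 0.
Proof.
move=> v0 /submxP[u ->].
by rewrite dotC -dot_mulmx trmx_mul mulmxA v0 mul0mx mxE.
Qed.

Lemma submx_dot k (B : 'M[K]_(k, n)) a :
  (forall v, v *m B^T = 0 -> dot a v = 0) -> (a <= B)%MS.
Proof.
move=> aB; rewrite submxE; apply/eqP/rowP => j; rewrite [RHS]mxE.
have : dot a (col j (cokermx B))^T = 0.
  by apply: aB; rewrite -trmx_mul colE mulmxA mulmx_coker mul0mx trmx0.
rewrite mxE /dot => e; rewrite -[RHS]e; apply: eq_bigr => i _; by rewrite !mxE.
Qed.

Lemma submx_span k (B : 'M[K]_(k, n)) v :
  (v <= B)%MS = (v \in <<[seq row i B | i <- enum 'I_k]>>%VS).
Proof.
apply/idP/idP => [/submxP[u ->]|].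
  rewrite mulmx_sum_row; apply: memv_suml => i _; apply: memvZ.
  by apply/memv_span/map_f; rewrite mem_enum.
move=> vB; have {vB} : v \in <<[tuple row i B | i < k]>>%VS by [].
move=> /coord_span ->; apply: summx_sub => i _; apply: scalemx_sub.
by rewrite nth_mktuple row_sub.
Qed.

Lemma dim_span_rows k (B : 'M[K]_(k, n)) : row_free B ->
  \dim <<[seq row i B | i <- enum 'I_k]>> = k.
Proof.
move=> freeB; suff : free [seq row i B | i <- enum 'I_k].
  by move=> /eqP ->; rewrite size_map size_enum_ord.
have -> : [seq row i B | i <- enum 'I_k] = [tuple row i B | i < k] by [].
apply/freeP => u; under eq_bigr do rewrite nth_mktuple.
move=> u0; have /eqP : (\row_i u i) *m B = 0.
  by rewrite mulmx_sum_row -[RHS]u0; apply: eq_bigr => i _; rewrite mxE.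
by rewrite mulmx_free_eq0 // => /eqP/rowP u00 i; have := u00 i; rewrite !mxE.
Qed.

(** A maximal free family of elements of S spans the linear span of S. *)
Lemma linear_span_rows S : exists B : 'M[K]_(\dim (linear_span S), n),
  [/\ row_free B, forall i, S (row i B) &
      forall v, (v \in linear_span S) = (v <= B)%MS].
Proof.
have [Sspan spanS] := svalP (cid (linear_span_exists S)).
rewrite -/(linear_span S) in Sspan spanS.
pose rows k :=
  `[< exists B : 'M[K]_(k, n), row_free B /\ forall i, S (row i B) >].
have ex_rows : exists k, rows k.
  exists 0%N; apply/asboolP; exists 0; split; last by case.
  by rewrite /row_free mxrank0.
have ub_rows k : rows k -> (k <= n)%N.
  move=> /asboolP[B [/eqP rB _]].
  by apply: leq_trans (rank_leq_col B); rewrite rB.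
case: (ex_maxnP ex_rows ub_rows) => k /asboolP[B [freeB SB]] max_k.
have subB v : S v -> (v <= B)%MS.
  move=> Sv; apply/negPn/negP => nvB; suff /max_k : rows k.+1 by rewrite ltnn.
  apply/asboolP; exists (col_mx v B); split.
    have : (\rank B < \rank (col_mx v B))%N.
      by rewrite -addsmxE rank_ltmx // /ltmx addsmxSr addsmx_sub (negPf nvB).
    by rewrite (eqP freeB) /row_free eqn_leq rank_leq_row.
  suff rows1 : forall i : 'I_(1 + k), S (row i (col_mx v B)) by exact: rows1.
  move=> i; rewrite -(splitK i); case: (split _) => j /=.
    by rewrite rowKu ord1 (_ : row 0 v = v) //; apply/rowP => l; rewrite mxE.
  by rewrite rowKd.
have memE v : (v \in linear_span S) = (v <= B)%MS.
  apply/idP/idP => [|/submxP[u ->]].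
    rewrite submx_span; apply: (subvP (spanS _ _)) => u /subB.
    by rewrite submx_span.
  by rewrite mulmx_sum_row; apply: memv_suml => i _; exact/memvZ/Sspan.
suff ek : k = \dim (linear_span S).
  by case: _ / ek; exists B.
rewrite -(dim_span_rows freeB); congr (\dim _).
by apply/vspaceP => v; rewrite memE submx_span.
Qed.

Lemma linear_span_free S k : (k <= \dim (linear_span S))%N ->
  exists B : 'M[K]_(k, n), row_free B /\ forall i, S (row i B).
Proof.
move=> le_k; have [B [freeB SB _]] := linear_span_rows S.
exists (pid_mx k *m B); split.
  by rewrite /row_free mxrankMfree // rank_pid_mx.
move=> i; have -> : row i (pid_mx k *m B) = row (widen_ord le_k i) B.
  rewrite row_mul [RHS]rowE; congr (_ *m _); apply/rowP => j; rewrite !mxE eqxx.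
  by rewrite ltn_ord andbT -val_eqE eq_sym.
exact: SB.
Qed.

Lemma dim_orthogonal (U : {vspace 'rV[K]_n}) k (B : 'M[K]_(k, n)) :
  (forall v, v \in U <-> v *m B^T = 0) -> \dim U = (n - \rank B)%N.
Proof.
move=> UB; pose S := [set v | v \in U].
have [C [freeC SC spanC]] := linear_span_rows S.
have spanU : linear_span S = U.
  have [Sspan spanS] := svalP (cid (linear_span_exists S)).
  apply/eqP; rewrite eqEsubv spanS //=; apply/subvP => v; exact: Sspan.
rewrite -{1}spanU -(eqP freeC) -(mxrank_tr B) -mxrank_ker; apply/eqmx_rank/andP.
split; apply/row_subP => i.
  by apply/sub_kermxP/UB/SC.
by rewrite -spanC spanU; apply/UB/sub_kermxP/row_sub.
Qed.
End LinearAlgebra.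

(** * Differential calculus of polynomials *)

Section PointDerivationsOfPolynomials.
Variables (K : comNzRingType) (n : nat).
Implicit Types F G : {mpoly K[n]}.

Lemma mpoly_ring_ind (Phi : {mpoly K[n]} -> Prop) :
  (forall c, Phi c%:MP) -> (forall i, Phi 'X_i) ->
  (forall F G, Phi F -> Phi G -> Phi (F + G)) ->
  (forall F G, Phi F -> Phi G -> Phi (F * G)) -> forall F, Phi F.
Proof.
move=> PC PX PD PM; apply: mpolyind => [|c m F _ _ PF]; first by rewrite -mpolyC0.
apply: (PD) => //; rewrite -mul_mpolyC; apply: (PM) => //; rewrite mpolyXE_id.
apply: (big_ind Phi) => // [|i _]; first by rewrite -mpolyC1.
by elim: (m i) => [|k IH]; rewrite ?expr0 ?exprS; [rewrite -mpolyC1|exact: PM].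
Qed.

Lemma mderiv_var i j : ('X_j : {mpoly K[n]})^`M(i) = ((j == i)%:R)%:MP.
Proof.
rewrite mderivX mnmE; case: eqP => [->|_]; last by rewrite scale0r mpolyC0.
rewrite scale1r (_ : (U_(i) - U_(i))%MM = 0%MM) ?mpolyX0 //.
by apply/mnmP => l; rewrite mnmBE subnn mnm0E.
Qed.

(** The chain rule: a derivation of the polynomial ring at z is determined by its
    values on the variables. *)
Lemma mpoly_derivationE (z : 'I_n -> K) (delta : {mpoly K[n]} -> K) :
  (forall c, delta c%:MP = 0) ->
  (forall F G, delta (F + G) = delta F + delta G) ->
  (forall F G, delta (F * G) = delta F * G.@[z] + F.@[z] * delta G) ->
  forall F, delta F = \sum_(i < n) (F^`M(i)).@[z] * delta 'X_i.
Proof.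
move=> dC dD dM; elim/mpoly_ring_ind.
- by move=> c; rewrite dC big1 // => i _; rewrite mderivC meval0 mul0r.
- move=> i; rewrite (bigD1 i) //= big1 => [|j ji].
    by rewrite mderiv_var eqxx mevalC mul1r addr0.
  by rewrite mderiv_var eq_sym (negPf ji) mevalC mul0r.
- move=> F G dF dG; rewrite dD dF dG -big_split; apply: eq_bigr => i _ /=.
  by rewrite mderivD mevalD mulrDl.
- move=> F G dF dG; rewrite dM dF dG mulr_suml mulr_sumr -big_split /=.
  apply: eq_bigr => i _; rewrite mderivM mevalD !mevalM; ring.
Qed.
End PointDerivationsOfPolynomials.

Section Differentials.
Variables (K : comNzRingType).

Definition grad n (F : {mpoly K[n]}) (p : 'rV[K]_n) : 'rV[K]_n :=
  \row_(i < n) (F^`M(i)).@[p 0].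

Definition differential n (z tau : 'rV[K]_n) (F : {mpoly K[n]}) : K :=
  \sum_(i < n) (F^`M(i)).@[z 0] * tau 0 i.

Lemma differentialC n (z tau : 'rV[K]_n) c : differential z tau c%:MP = 0.
Proof.
by rewrite /differential big1 // => i _; rewrite mderivC meval0 mul0r.
Qed.

Lemma differentialD n (z tau : 'rV[K]_n) F G :
  differential z tau (F + G) = differential z tau F + differential z tau G.
Proof.
by rewrite -big_split; apply: eq_bigr => i _; rewrite mderivD mevalD mulrDl.
Qed.

Lemma differentialM n (z tau : 'rV[K]_n) F G :
  differential z tau (F * G) =
  differential z tau F * G.@[z 0] + F.@[z 0] * differential z tau G.
Proof.
rewrite /differential mulr_suml mulr_sumr -big_split; apply: eq_bigr => i _ /=.
rewrite mderivM mevalD !mevalM; ring.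
Qed.

Lemma differentialN n (z tau : 'rV[K]_n) F :
  differential z tau (- F) = - differential z tau F.
Proof.
rewrite /differential -sumrN; apply: eq_bigr => i _.
by rewrite mderivN mevalN mulNr.
Qed.

Lemma differential_sum n (z tau : 'rV[K]_n) (I : finType)
    (F : I -> {mpoly K[n]}) :
  differential z tau (\sum_i F i) = \sum_i differential z tau (F i).
Proof.
apply: (big_morph (differential z tau) (differentialD z tau)).
by rewrite -mpolyC0 differentialC.
Qed.

Lemma differentialX n (z tau : 'rV[K]_n) i : differential z tau 'X_i = tau 0 i.
Proof.
rewrite /differential (bigD1 i) //= big1 => [|j ji].
  by rewrite mderiv_var eqxx mevalC mul1r addr0.
by rewrite mderiv_var eq_sym (negPf ji) mevalC mul0r.
Qed.

Lemma mderiv_comp n m (F : {mpoly K[n]}) (lq : n.-tuple {mpoly K[m]}) i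
    (z : 'I_m -> K) :
  ((F \mPo lq)^`M(i)).@[z] = \sum_(j < n)
    (F^`M(j)).@[fun j => (tnth lq j).@[z]] * ((tnth lq j)^`M(i)).@[z].
Proof.
rewrite (@mpoly_derivationE _ _ (fun j => (tnth lq j).@[z])
  (fun F => ((F \mPo lq)^`M(i)).@[z])).
- by apply: eq_bigr => j _; rewrite comp_mpolyXU (tnth_nth 0).
- by move=> c; rewrite comp_mpolyC mderivC meval0.
- by move=> F' G; rewrite comp_mpolyD mderivD mevalD.
- move=> F' G; rewrite rmorphM mderivM mevalD !mevalM !comp_mpoly_meval //.
Qed.
End Differentials.

(** * Tangent spaces and lines *)

Section ConesAndTangents.
Variables (K : closedFieldType) (N : nat).
Local Notation V := 'rV[K]_N.+1.
Local Notation P := (proj_space K N).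
Implicit Types (F : {mpoly K[N.+1]}) (X Y : set P) (x h : P) (p q a v : V).

Lemma dot_grad F p v : dot (grad F p) v = \sum_i (F^`M(i)).@[p 0] * v 0 i.
Proof. by apply: eq_bigr => i _; rewrite mxE. Qed.

Lemma poly_eq0_punctured (q : {poly K}) :
  (forall c, c != 0 -> q.[c] = 0) -> q = 0.
Proof.
move=> q0; apply/eqP.
rewrite -(mulIr_eq0 _ (@mulIf _ ('X : {poly K}) _)) ?polyX_eq0 //.
apply/negPn/negP => /closed_nonrootP[c]; rewrite rootE hornerM hornerX mulf_eq0.
by have [//|/q0 ->] := eqVneq c 0; rewrite ?orbT ?eqxx.
Qed.

(** The restriction of F to the line spanned by p, as a polynomial in the
    coordinate c of c p. *)
Definition line_poly F p : {poly K} :=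
  \poly_(d < msize F) (pihomog mdeg d F).@[p 0].

Lemma horner_line_poly F p c : (line_poly F p).[c] = F.@[(c *: p) 0].
Proof.
rewrite [in RHS](@pihomog_partitionE _ _ mdeg (msize F) F (leqnn _)).
rewrite horner_poly raddf_sum /=; apply: eq_bigr => d _.
by rewrite (homog_eval_scale _ _ (pihomogP _ _ F)) mulrC.
Qed.

Lemma mem_tangent_space (J : set {mpoly K[N.+1]}) x v :
  v \in tangent_space J x <->
  forall F p, J F -> p \in line x -> dot (grad F p) v = 0.
Proof.
split=> [vT F p JF px|vJ].
  have [B [_ SB spanB]] := linear_span_rows [set v : V | forall F p, J F ->
    p \in line x -> \sum_(i < N.+1) (F^`M(i)).@[p 0] * v 0 i = 0].
  rewrite dotC; apply: (@dot_submx _ _ _ B); last by rewrite -spanB.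
  by apply/mul_trmx_eq0 => i; rewrite dotC dot_grad; exact: SB.
have [Sspan _] := svalP (cid (linear_span_exists [set v : V | forall F p, J F ->
  p \in line x -> \sum_(i < N.+1) (F^`M(i)).@[p 0] * v 0 i = 0])).
by apply: Sspan => F p JF px; rewrite -dot_grad; exact: vJ.
Qed.

Lemma grad_scale F p c :
  grad (F \mPo [tuple c *: 'X_i | i < N.+1]) p = c *: grad F (c *: p).
Proof.
apply/rowP => i; rewrite !mxE mderiv_comp (bigD1 i) //= big1 => [|j ji].
  rewrite tnth_mktuple mderivZ mevalZ mderiv_var eqxx mevalC mulr1 addr0 mulrC.
  congr (_ * _); apply: meval_eq => j.
  by rewrite tnth_mktuple mevalZ mevalXU mxE.
by rewrite tnth_mktuple mderivZ mevalZ mderiv_var (negPf ji) mevalC !mulr0.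
Qed.

(** The tangent space can be computed at one nonzero point p of the line, although
    its equations range over the whole line, the origin included.  At c p with
    c nonzero the equation of F follows from that of the rescaled polynomial F(c X),
    which also vanishes on X; at the origin it follows because the equation is
    polynomial in c. *)
Lemma mem_tangent_space_at X x p v : X x -> p \in line x -> p != 0 ->
  v \in tangent_space (vanishing_ideal X) x <->
  forall F, vanishing_ideal X F -> dot (grad F p) v = 0.
Proof.
move=> Xx px p0; rewrite mem_tangent_space; split=> [vT F XF|vT F q XF qx].
  exact: vT.
have [c ->] := line_scale px p0 qx.
pose G := \sum_i v 0 i *: F^`M(i).
have GE q' : G.@[q' 0] = dot (grad F q') v.
  rewrite raddf_sum dot_grad; apply: eq_bigr => i _ /=.
  by rewrite mevalZ mulrC.
rewrite -GE -horner_line_poly (_ : line_poly G p = 0) ?horner0 //.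
apply: poly_eq0_punctured => e e0; rewrite horner_line_poly GE.
have : dot (grad (F \mPo [tuple e *: 'X_i | i < N.+1]) p) v = 0.
  apply: vT => y r Xy ry; rewrite comp_mpoly_meval.
  rewrite -[RHS](XF y (e *: r) Xy (memvZ _ ry)); apply: meval_eq => i.
  by rewrite tnth_mktuple mevalZ mevalXU mxE.
rewrite grad_scale /dot; under eq_bigr do rewrite mxE -mulrA.
by rewrite -mulr_sumr => /eqP; rewrite mulf_eq0 (negPf e0) => /eqP.
Qed.

(** * The conormal variety is isotropic *)

Definition lift_point F : {mpoly K[N.+1 + N.+1]} :=
  F \mPo [tuple 'X_(lshift N.+1 i) | i < N.+1].

Lemma meval_lift F p a : (lift_point F).@[row_mx p a 0] = F.@[p 0].
Proof.
rewrite comp_mpoly_meval; apply: meval_eq => i.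
by rewrite tnth_mktuple mevalXU row_mxEl.
Qed.

Lemma differential_lift F p a tau :
  differential (row_mx p a) tau (lift_point F) = dot (grad F p) (lsubmx tau).
Proof.
rewrite (@mpoly_derivationE _ _ (p 0)
  (fun F => differential (row_mx p a) tau (lift_point F))).
- rewrite dot_grad; apply: eq_bigr => i _; congr (_ * _).
  by rewrite /lift_point comp_mpolyXU -tnth_nth tnth_mktuple differentialX mxE.
- by move=> c; rewrite /lift_point comp_mpolyC differentialC.
- by move=> F' G; rewrite /lift_point comp_mpolyD differentialD.
- by move=> F' G; rewrite /lift_point rmorphM differentialM !meval_lift.
Qed.

Definition conormal_tangent X p a tau := forall G,
  conormal_ideal X G -> differential (row_mx p a) tau G = 0.

Lemma lift_vanishing X F :
  vanishing_ideal X F -> conormal_ideal X (lift_point F).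
Proof.
by move=> XF x h p a [/= Xx _] px _; rewrite meval_lift; exact: XF Xx px.
Qed.

(** Where c = N - d polynomials of the ideal of X have independent gradients, they
    cut out the tangent space of X, by equality of dimensions; so every conormal
    form is a combination of these gradients. *)
Lemma conormal_span X d (c : nat) (F : 'I_c -> {mpoly K[N.+1]}) x p a :
  (forall i, vanishing_ideal X (F i)) -> (c + d.+1 = N.+1)%N ->
  X x -> p \in line x -> p != 0 ->
  \dim (tangent_space (vanishing_ideal X) x) = d.+1 ->
  (forall v, v \in tangent_space (vanishing_ideal X) x -> dot a v = 0) ->
  row_free (\matrix_(i < c) grad (F i) p) ->
  (a <= \matrix_(i < c) grad (F i) p)%MS.
Proof.
move=> XF cd Xx px p0 dimT aT; set B := \matrix_i _ => freeB.
pose U : {vspace V} := lker (linfun (mulmxr B^T)).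
have UE v : v \in U <-> v *m B^T = 0.
  by rewrite memv_ker lfunE; split=> [/eqP|/eqP].
have eqT : tangent_space (vanishing_ideal X) x = U.
  apply/eqP; rewrite eqEdim dimT (dim_orthogonal UE) (eqP freeB).
  apply/andP; split; last by rewrite -cd addKn.
  apply/subvP => v /(mem_tangent_space_at _ Xx px p0) vT.
  by apply/UE/mul_trmx_eq0 => i; rewrite rowK; exact: vT.
by apply: submx_dot => v /UE; rewrite -eqT; exact: aT.
Qed.

(** Explicit equations of the conormal variety.  A conormal form a is a combination
    u B of the rows of the jacobian B of the F i.  To recover u, project B to
    a square matrix B C by a constant matrix C and apply Cramer's rule:
    det(B C) u = a C adj(B C).  This needs no choice of a minor of B. *)
Section Equations.
Variables (c : nat) (F : 'I_c -> {mpoly K[N.+1]}) (C : 'M[K]_(N.+1, c)).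
Local Notation Kxy := {mpoly K[N.+1 + N.+1]}.

Definition jacobian : 'M[Kxy]_(c, N.+1) :=
  \matrix_(i, k) lift_point ((F i)^`M(k)).
Definition projected_jacobian : 'M[Kxy]_c :=
  jacobian *m map_mx (@mpolyC (N.+1 + N.+1) K) C.
Definition dual_vars : 'rV[Kxy]_N.+1 := \row_k 'X_(rshift N.+1 k).
Definition multipliers : 'rV[Kxy]_c :=
  dual_vars *m map_mx (@mpolyC (N.+1 + N.+1) K) C *m \adj projected_jacobian.
Definition normal_equations : 'rV[Kxy]_N.+1 :=
  \det projected_jacobian *: dual_vars - multipliers *m jacobian.

Variables (p a : V).
Local Notation ev := (meval (row_mx p a 0)).
Let B : 'M[K]_(c, N.+1) := \matrix_i grad (F i) p.

Lemma ev_jacobian : map_mx ev jacobian = B.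
Proof. by apply/matrixP => i k; rewrite !mxE meval_lift. Qed.

Lemma ev_const : map_mx ev (map_mx (@mpolyC (N.+1 + N.+1) K) C) = C.
Proof. by apply/matrixP => i k; rewrite !mxE mevalC. Qed.

Lemma ev_projected : map_mx ev projected_jacobian = B *m C.
Proof. by rewrite map_mxM ev_jacobian ev_const. Qed.

Lemma ev_det : ev (\det projected_jacobian) = \det (B *m C).
Proof. by rewrite -det_map_mx ev_projected. Qed.

Lemma ev_dual_vars : map_mx ev dual_vars = a.
Proof. by apply/rowP => k; rewrite !mxE mevalXU row_mxEr. Qed.

Lemma ev_multipliers : map_mx ev multipliers = a *m C *m \adj (B *m C).
Proof. by rewrite !map_mxM map_mx_adj ev_projected ev_const ev_dual_vars. Qed.

Lemma ev_normal_equations : map_mx ev normal_equations =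
  \det (B *m C) *: a - (a *m C *m \adj (B *m C)) *m B.
Proof.
rewrite map_mxB map_mxZ map_mxM /=.
by rewrite ev_det ev_dual_vars ev_multipliers ev_jacobian.
Qed.

Lemma normal_equations_vanish : (a <= B)%MS -> map_mx ev normal_equations = 0.
Proof.
move=> /submxP[u aE]; rewrite ev_normal_equations aE -!mulmxA (mulmxA B C).
rewrite (mulmxA (B *m C)) mul_mx_adj mul_scalar_mx -scalemxAr subrr.
by [].
Qed.
End Equations.

(** Near (p, a), the conormal variety is given by F i = 0 and
    a = sum_i lambda_i grad (F i).  Differentiating the last equation along
    a tangent vector tau, and pairing with the first half of another tangent
    vector sigma, which is orthogonal to a and to all the gradients, only leaves
    the sum of the Hessians of the F i weighted by lambda_i.  This is symmetric in
    tau and sigma. *)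
Lemma conormal_isotropic X d x p a tau sigma :
  (forall y, X y -> \dim (tangent_space (vanishing_ideal X) y) = d.+1) ->
  X x -> p \in line x -> p != 0 ->
  (forall G, conormal_ideal X G -> G.@[row_mx p a 0] = 0) ->
  conormal_tangent X p a tau -> conormal_tangent X p a sigma ->
  dot (rsubmx tau) (lsubmx sigma) = dot (rsubmx sigma) (lsubmx tau).
Proof.
move=> smooth Xx px p0 XG Ttau Tsigma.
have [B [freeB gradB spanB]] := linear_span_rows
  [set w | exists F, vanishing_ideal X F /\ w = grad F p].
set c := \dim _ in B freeB gradB spanB.
have /choice[F FP] := gradB.
have BE : B = \matrix_i grad (F i) p.
  by apply/row_matrixP => i; rewrite rowK (FP i).2.
have XF i : vanishing_ideal X (F i) := (FP i).1.
have [Wspan _] := svalP (cid (linear_span_exists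
  [set w | exists F, vanishing_ideal X F /\ w = grad F p])).
have cd : (c + d.+1 = N.+1)%N.
  rewrite -(smooth x Xx) -{1}(eqP freeB) (@dim_orthogonal _ _ _ _ B).
    by rewrite subnKC // rank_leq_col.
  move=> v; rewrite (mem_tangent_space_at _ Xx px p0) -mul_trmx_eq0; split.
    by move=> vT i; rewrite (FP i).2; exact: vT.
  move=> vB G XG'; apply: (@dot_submx _ _ _ B); first exact/mul_trmx_eq0.
  by rewrite -spanB; apply: Wspan; exists G.
pose C := pinvmx B.
have /rV0Pn[j pj] := p0.
(* The factor det makes the equations hold where B C is singular, and the
   coordinate X_j, nonzero at p, makes them hold at the origin, which belongs to
   every line. *)
pose m := \det (projected_jacobian F C) * 'X_(lshift N.+1 j).
pose H := normal_equations F C.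
have IG k : conormal_ideal X (m * H 0 k).
  move=> y h q b [/= Xy bT] qy bh; rewrite !mevalM mevalXU row_mxEl ev_det.
  have [q0|q0] := eqVneq q 0; first by rewrite q0 mxE mulr0 mul0r.
  set Bq := \matrix_i _; have [->|det0] := eqVneq (\det (Bq *m C)) 0.
    by rewrite !mul0r.
  suff /(normal_equations_vanish C)/rowP/(_ k) : (b <= Bq)%MS.
    by rewrite !mxE -/H => ->; rewrite mulr0.
  apply: (conormal_span XF cd Xy qy q0 (smooth y Xy)).
    by move=> v vT; exact: bT.
  rewrite /row_free eqn_leq rank_leq_row /=.
  have /mxrank_unit {1}<- : Bq *m C \in unitmx by rewrite unitmxE unitfE.
  exact: mxrankM_maxl.
have mE : m.@[row_mx p a 0] = p 0 j.
  rewrite mevalM mevalXU row_mxEl ev_det -BE mulmxVp // det1 mul1r //.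
have H0 k : (H 0 k).@[row_mx p a 0] = 0.
  have /eqP := XG _ (IG k); rewrite mevalM mE mulf_eq0 (negPf pj) => /eqP //.
have detE : (\det (projected_jacobian F C)).@[row_mx p a 0] = 1.
  by rewrite ev_det -BE mulmxVp // det1.
pose lam i := (multipliers F C 0 i).@[row_mx p a 0].
have aB : (a <= B)%MS.
  have : map_mx (meval (row_mx p a 0)) H = 0.
    by apply/rowP => k; rewrite mxE [RHS]mxE; exact: H0.
  rewrite ev_normal_equations -BE mulmxVp // det1 scale1r => /eqP.
  by rewrite subr_eq0 => /eqP ->; exact: submxMl.
(* lam does not depend on t and s, so the right-hand side is symmetric. *)
have half t s : conormal_tangent X p a t -> conormal_tangent X p a s ->
    dot (rsubmx t) (lsubmx s) = \sum_i lam i * \sum_k \sum_l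
      ((F i)^`M(k)^`M(l)).@[p 0] * lsubmx t 0 l * lsubmx s 0 k.
  move=> Tt Ts.
  have Fs i : dot (grad (F i) p) (lsubmx s) = 0.
    by rewrite -(differential_lift _ _ a); apply: Ts; exact: lift_vanishing.
  have as0 : dot a (lsubmx s) = 0.
    apply: dot_submx aB; apply/mul_trmx_eq0 => i.
    by rewrite (FP i).2.
  have dH k : differential (row_mx p a) t (H 0 k) = 0.
    have /eqP := Tt _ (IG k); rewrite differentialM H0 mulr0 add0r mE mulf_eq0.
    by rewrite (negPf pj) => /eqP.
  have dHE k : rsubmx t 0 k +
      differential (row_mx p a) t (\det (projected_jacobian F C)) * a 0 k =
    \sum_i (
      differential (row_mx p a) t (multipliers F C 0 i) * grad (F i) p 0 k +
      lam i * \sum_l ((F i)^`M(k)^`M(l)).@[p 0] * lsubmx t 0 l).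
    apply/eqP; rewrite -subr_eq0 -[X in _ == X](dH k); apply/eqP.
    have HE : H 0 k = \det (projected_jacobian F C) * 'X_(rshift N.+1 k) -
        \sum_i multipliers F C 0 i * lift_point ((F i)^`M(k)).
      rewrite /H /normal_equations mxE [X in X + _]mxE.
      congr (_ * _ + _); first by rewrite mxE.
      rewrite mxE; congr (- _); rewrite mxE; apply: eq_bigr => i _.
      by congr (_ * _); rewrite mxE.
    rewrite HE differentialD differentialN differentialM differentialX detE.
    rewrite mul1r mevalXU row_mxEr.
    congr (_ - _); first by rewrite addrC mxE.
    rewrite differential_sum; apply: eq_bigr => i _.
    rewrite differentialM meval_lift differential_lift dot_grad.
    by rewrite [grad _ _ _ _]mxE.
  have : \sum_k (rsubmx t 0 k +
        differential (row_mx p a) t (\det (projected_jacobian F C)) * a 0 k) *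
      lsubmx s 0 k = dot (rsubmx t) (lsubmx s).
    under eq_bigr do rewrite mulrDl -mulrA.
    by rewrite big_split /= -mulr_sumr -/(dot a _) as0 mulr0 addr0.
  move=> <-; under eq_bigr do rewrite dHE mulr_suml.
  rewrite exchange_big /=; apply: eq_bigr => i _.
  under eq_bigr do rewrite mulrDl -!mulrA.
  rewrite big_split /= -!mulr_sumr -/(dot _ _) Fs mulr0 add0r; congr (_ * _).
  by apply: eq_bigr => k _; rewrite mulr_suml.
rewrite (half tau sigma) // (half sigma tau) //; apply: eq_bigr => i _.
congr (_ * _); rewrite exchange_big /=; apply: eq_bigr => l _.
by apply: eq_bigr => k _; rewrite mderiv_comm mulrAC.
Qed.

(** * Cones over irreducible sets *)

Definition polyfun : set (V -> K) := [set f | exists F, f = fun a => F.@[a 0]].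

Lemma subalgebra_polyfun : subalgebra polyfun.
Proof.
split=> [c|f g [F ->] [G ->]|f g [F ->] [G ->]].
- by exists c%:MP; apply/funext => a; rewrite mevalC.
- by exists (F + G); apply/funext => a; rewrite mevalD.
- by exists (F * G); apply/funext => a; rewrite mevalM.
Qed.

Definition cone Y : set V := [set a | exists2 h, Y h & a \in line h].

(** F need not be homogeneous, so it defines a closed set of lines only through its
    homogeneous components. *)
Definition homog_components F : set {mpoly K[N.+1]} :=
  [set G | exists d : 'I_(msize F), G = pihomog mdeg d F].

Lemma homogeneous_homog_components F : homogeneous (homog_components F).
Proof. by move=> G [d ->]; exists d; exact: pihomogP. Qed.

Lemma zeros_components F h :
  zeros (homog_components F) h <-> forall a, a \in line h -> F.@[a 0] = 0.
Proof.
split=> [hF a ha|hF G a [d ->] ha].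
  rewrite [F](@pihomog_partitionE _ _ mdeg (msize F) F (leqnn _)) raddf_sum /=.
  by apply: big1 => d _; apply: hF => //; exists d.
have /(congr1 (fun q : {poly K} => q`_d)) : line_poly F a = 0.
  apply: poly_eq0_punctured => c _; rewrite horner_line_poly; apply: hF.
  exact: memvZ.
by rewrite coef_poly ltn_ord coef0.
Qed.

Lemma closed_zeros (J : set {mpoly K[N.+1]}) :
  homogeneous J -> closed (zeros J).
Proof.
by move=> hJ; rewrite -[zeros J]setCK; apply: open_closedC; exists J.
Qed.

Lemma closed_zerosP (A : set P) : closed A -> exists J, A = zeros J.
Proof.
move=> /closed_openC [J [_ /(congr1 (@setC _))]]; rewrite !setCK => ->.
by exists J.
Qed.

(** A product that vanishes on the cone vanishes on each of its lines, on which one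
    of the factors is then zero; irreducibility of Y makes the choice of the
    factor uniform. *)
Lemma domain_on_cone Y : irreducible Y -> domain_on polyfun (cone Y).
Proof.
move=> [[h Yh] irrY]; split; first by exists 0, h => //; exact: mem0v.
move=> _ _ [F ->] [G ->] FG0.
have sY : Y `<=` zeros (homog_components F) `|` zeros (homog_components G).
  move=> y Yy; have [p py p0] := line_neq0 y.
  have vanish F' : line_poly F' p = 0 -> zeros (homog_components F') y.
    move=> F'0; apply/zeros_components => a /(line_scale py p0)[c ->].
    by rewrite -horner_line_poly F'0 horner0.
  have /eqP : line_poly F p * line_poly G p = 0.
    apply: poly_eq0_punctured => c _; rewrite hornerM !horner_line_poly.
    by apply: FG0; exists y => //; exact: memvZ.
  by rewrite mulf_eq0 => /orP[/eqP/vanish|/eqP/vanish]; [left|right].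
have [] := irrY _ _ _ _ sY.
- exact/closed_zeros/homogeneous_homog_components.
- exact/closed_zeros/homogeneous_homog_components.
- by move=> YF; left=> a [y /YF/zeros_components]; exact.
- by move=> YG; right=> a [y /YG/zeros_components]; exact.
Qed.

(** * Points and tangent vectors of the tangency scheme *)

Lemma grad_specialize a (G : {mpoly K[N.+1 + N.+1]}) p :
  grad (specialize a G) p = \row_i (G^`M(lshift N.+1 i)).@[row_mx p a 0].
Proof.
apply/rowP => i; rewrite !mxE mderiv_comp big_split_ord /= addrC.
rewrite big1; last first.
  move=> j _; rewrite tnth_mktuple -[rshift _ j]/(unsplit (inr j)) unsplitK.
  by rewrite mderivC meval0 mulr0.
rewrite add0r (bigD1 i) //= big1 => [|j ji]; last first.
  rewrite tnth_mktuple -[lshift _ j]/(unsplit (inl j)) unsplitK mderiv_var.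
  by rewrite (negPf ji) mevalC mulr0.
rewrite tnth_mktuple -[lshift _ i]/(unsplit (inl i)) unsplitK mderiv_var eqxx.
rewrite mevalC addr0 mulr1; apply: meval_eq => j; rewrite tnth_mktuple -[j]splitK.
case: (split j) => l; rewrite unsplitK /=.
  by rewrite mevalXU row_mxEl.
by rewrite mevalC row_mxEr.
Qed.

Lemma meval_specialize a (G : {mpoly K[N.+1 + N.+1]}) p :
  (specialize a G).@[p 0] = G.@[row_mx p a 0].
Proof.
rewrite comp_mpoly_meval; apply: meval_eq => j; rewrite tnth_mktuple -[j]splitK.
case: (split j) => l; rewrite unsplitK /=.
  by rewrite mevalXU row_mxEl.
by rewrite mevalC row_mxEr.
Qed.

Lemma differential_row_mx0 p a v (G : {mpoly K[N.+1 + N.+1]}) :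
  differential (row_mx p a) (row_mx v 0) G = dot (grad (specialize a G) p) v.
Proof.
rewrite grad_specialize /differential big_split_ord /= addrC big1 ?add0r => [|j _].
  by apply: eq_bigr => j _; rewrite row_mxEl mxE.
by rewrite row_mxEr mxE mulr0.
Qed.

(** What the tangency span provides at h: as many independent tangent vectors v as
    its dimension allows, taken at points p of X such that (p, a) satisfies the
    equations of the conormal variety and (v, 0) is tangent to it there. *)
Lemma tangency_vectors X h a k : closed X -> a \in line h -> a != 0 ->
  (k <= \dim (tangency_span X h))%N ->
  exists (p : 'I_k -> V) (B : 'M[K]_(k, N.+1)), row_free B /\
    forall j, [/\ exists2 x, X x & p j \in line x, p j != 0,
      forall G, conormal_ideal X G -> G.@[row_mx (p j) a 0] = 0 &
      conormal_tangent X (p j) a (row_mx (row j B) 0)].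
Proof.
move=> clX ha a0 /linear_span_free[B [freeB SB]].
suff /choice[p pP] : forall j, exists p : V,
  [/\ exists2 x, X x & p \in line x, p != 0,
    forall G, conormal_ideal X G -> G.@[row_mx p a 0] = 0 &
    conormal_tangent X p a (row_mx (row j B) 0)] by exists p, B.
move=> j; have [x x0 /mem_tangent_space xT] := SB j.
have [p px p0] := line_neq0 x.
have spec G : conormal_ideal X G -> tangency_ideal X h (specialize a G).
  by move=> XG; exists a, G.
exists p; split=> //.
- exists x => //; have [J XJ] := closed_zerosP clX; rewrite XJ => F q JF qx.
  have : tangency_ideal X h (specialize a (lift_point F)).
    apply/spec/lift_vanishing => y q' Xy q'y.
    by move: Xy; rewrite XJ => /(_ F q' JF q'y).
  by move=> /x0 /(_ qx); rewrite meval_specialize meval_lift.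
- by move=> G /spec/x0 /(_ px); rewrite meval_specialize.
- by move=> G /spec XG; rewrite differential_row_mx0; exact: xT.
Qed.

Lemma pder_meval (T : Type) A (M : set T) m D n (z : T -> 'rV[K]_n)
    (F : {mpoly K[n]}) :
  subalgebra A -> point_derivation A M m D ->
  (forall i, A (fun t => z t 0 i)) ->
  A (fun t => F.@[z t 0]) /\
  D (fun t => F.@[z t 0]) = differential (z m) (\row_i D (fun t => z t 0 i)) F.
Proof.
move=> algA derD Az; elim/mpoly_ring_ind: F.
- move=> c; under eq_fun do rewrite mevalC; rewrite differentialC (pderC derD).
  by split=> //; exact: (subalgC algA).
- by move=> i; under eq_fun do rewrite mevalXU; rewrite differentialX mxE.
- move=> F1 G [AF DF] [AG DG]; under eq_fun do rewrite mevalD.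
  by rewrite (pderD derD) // DF DG differentialD; split=> //; exact: subalgD.
- move=> F1 G [AF DF] [AG DG]; under eq_fun do rewrite mevalM.
  by rewrite (pderM derD) // DF DG differentialM; split=> //; exact: subalgM.
Qed.

(** * The dimension bound *)

Hypothesis char0 : [pchar K] =i pred0.

(** The origin is put in front, so that a chain of length n gives n + 1 separating
    polynomials; the first one accounts for the scaling of the cone. *)
Definition cone_chain (Y : nat -> set P) i : set V :=
  if i is i'.+1 then cone (Y i') else [set 0].

Section ConeChain.
Variables (S : set P) (n : nat) (Y : nat -> set P).
Hypothesis irrY : forall i, (i <= n)%N ->
  irreducible (Y i) /\ exists A, closed A /\ Y i = A `&` S.
Hypothesis monoY : forall i, (i < n)%N -> Y i `<` Y i.+1.

Lemma chain_subset i : (i <= n)%N -> Y i `<=` S.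
Proof. by move=> /irrY[_ [A [_ ->]]] h []. Qed.

Lemma domain_on_cone_chain i :
  (i <= n.+1)%N -> domain_on polyfun (cone_chain Y i).
Proof.
case: i => [_|i le]; last by apply: domain_on_cone; case: (irrY le).
split; first by exists 0.
move=> f g _ _ /(_ 0 erefl)/eqP; rewrite mulf_eq0.
by move=> /orP[]/eqP fg0; [left|right] => _ ->.
Qed.

Lemma cone_chain_mono i :
  (i < n.+1)%N -> cone_chain Y i `<=` cone_chain Y i.+1.
Proof.
case: i => [_ _ ->|i lt a [h Yh ah]].
  by have [[[h Yh] _] _] := irrY (leq0n n); exists h => //; exact: mem0v.
by exists h => //; exact: (monoY lt).1.
Qed.

Lemma cone_chain_separated i : (i < n.+1)%N -> exists F : {mpoly K[N.+1]},
  vanishes (fun a : V => F.@[a 0]) (cone_chain Y i) /\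
  ~ vanishes (fun a : V => F.@[a 0]) (cone_chain Y i.+1).
Proof.
case: i => [_|i lt].
  have [[[h Yh] _] _] := irrY (leq0n n).
  have [a ah /rV0Pn[i ai]] := line_neq0 h; exists 'X_i; split.
    by move=> _ ->; rewrite mevalXU mxE.
  by move=> /(_ a (ex_intro2 _ _ h Yh ah))/eqP; rewrite mevalXU (negPf ai).
have [h Yh nYh] : exists2 h, Y i.+1 h & ~ Y i h.
  apply: contrapT => nh; apply: (monoY lt).2 => h Yh.
  by apply: contrapT => nYh; apply: nh; exists h.
have [_ [A [clA YA]]] := irrY (ltnW lt).
have [J AJ] := closed_zerosP clA.
have : ~ A h.
  by move=> Ah; apply: nYh; rewrite YA; split=> //; exact: chain_subset Yh.
rewrite AJ => nz; have [F JF [p ph Fp]] : exists2 F, J F &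
    exists2 p : V, p \in line h & F.@[p 0] <> 0.
  apply: contrapT => nF; apply: nz => F p JF ph; apply: contrapT => Fp.
  by apply: nF; exists F => //; exists p.
exists F; split.
  by move=> a [y]; rewrite YA AJ => -[zy _] ay; exact: zy.
by move=> /(_ p) F0; apply: Fp; apply: F0; exists h.
Qed.
End ConeChain.

Lemma irreducible_chain_bound (S : set P) (n k : nat) X :
  smooth_variety X ->
  (forall h, S h -> (k <= \dim (tangency_span X h))%N) ->
  irreducible_chain S n -> (n + k <= N)%N.
Proof.
move=> [clX _ [d _ smooth]] Sk [Y [irrY monoY]].
have YS := chain_subset irrY; have domC := domain_on_cone_chain irrY.
have monoC := cone_chain_mono irrY monoY.
have ex_b i : exists F : {mpoly K[N.+1]}, (i < n.+1)%N ->
    vanishes (fun a : V => F.@[a 0]) (cone_chain Y i) /\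
    ~ vanishes (fun a : V => F.@[a 0]) (cone_chain Y i.+1).
  have [lt|nlt] := pselect (i < n.+1)%N; last by exists 0.
  by have [F FP] := cone_chain_separated irrY monoY lt; exists F.
have /choice[F FP] := ex_b.
pose b i (a : V) := (F i).@[a 0].
have [i|A [algA Apoly derA]] :=
  chain_derivations (b := b) subalgebra_polyfun domC monoC.
  by move=> lt; have [? ?] := FP i lt; split=> //; exists (F i).
have [x0 Yx0] : Y n !=set0 by have [[]] := irrY n (leqnn n).
have [a0 ha0 /rV0Pn[i0 a0i0]] := line_neq0 x0.
pose M1 := [set a : V | cone (Y n) a /\ a != 0].
(* Vectors of the tangency scheme exist only for a nonzero. *)
have denseM1 : dense_in polyfun M1 (cone (Y n)).
  split=> [a []//|f pf f0].
  have [] := @dense_neq0 _ _ polyfun (cone (Y n)) (fun a => a 0 i0).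
  - exact: subalgebra_polyfun.
  - exact: (domC n.+1).
  - by exists 'X_i0; apply/funext => a; rewrite mevalXU.
  - by move=> /(_ a0 (ex_intro2 _ _ x0 Yx0 ha0))/eqP; rewrite (negPf a0i0).
  - move=> _; apply=> // a [Ca ai]; apply: f0; split=> //.
    by apply: contraTneq ai => ->; rewrite /= mxE eqxx.
have denseA : dense_in A M1 (cone (Y n)).
  by split; [exact: denseM1.1|move=> f /Apoly; exact: denseM1.2].
have domA : domain_on A (cone (Y n)).
  have dom := domC n.+1 (leqnn _); split; first exact: domain_neq0 dom.
  by move=> f g /Apoly Af /Apoly Ag; exact: (domain_mul dom).
(* For each a, k points p_j(a) of the tangency scheme of a and the matrix of k
   independent tangent vectors at these points, chosen arbitrarily. *)
have ex_p a : exists pB : ('I_k -> V) * 'M[K]_(k, N.+1), M1 a ->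
    row_free pB.2 /\ forall j,
    [/\ exists2 x, X x & pB.1 j \in line x, pB.1 j != 0,
      forall G, conormal_ideal X G -> G.@[row_mx (pB.1 j) a 0] = 0 &
      conormal_tangent X (pB.1 j) a (row_mx (row j pB.2) 0)].
  have [[[h Yh ah] aN0]|nM1] := pselect (M1 a); last by exists (fun=> 0, 0).
  have [p [B pB]] := tangency_vectors clX ah aN0 (Sk h (YS n (leqnn n) h Yh)).
  by exists (p, B).
have /choice[pB pBP] := ex_p; pose p a := (pB a).1; pose B a := (pB a).2.
(* The functions to be made differentiable: the coordinates of a and of p_j(a). *)
pose z (i : 'I_N.+1 + 'I_k * 'I_N.+1) (a : V) : K :=
  match i with inl i => a 0 i | inr (j, i) => p a j 0 i end.
have [A' [M' [[algA' _] zA' denseM' [m M'm] der']]] :=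
  generic_adjoin_seq z (enum {: 'I_N.+1 + 'I_k * 'I_N.+1}) char0 algA
    (domain_dense algA domA denseA).
have Az i : A' (z i) by apply: zA'; rewrite mem_enum.
have Mm := denseM'.1 m M'm.
have ex_D i : exists D, point_derivation A' M' m D /\
    forall l, (l < n.+1)%N -> D (b l) = (l == i)%:R.
  have [D [derD Db]] := derA m (fun l => (l == i)%:R) Mm.1.
  have [|D' [derD' D'D]] := der' m D M'm.
    split; [exact: pderC derD|exact: pderD derD|exact: pderM derD|].
    move=> f Af f0; apply: (pder0 derD) => //.
    by apply: denseA.2 => //; exact: denseM'.2.
  by exists D'; split=> // l lt; have [Ab <-] := Db l lt; exact: D'D.
have /choice[D DP] := ex_D.
(* eta i is the velocity of a along the i-th derivation, w below that of p_j. *)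
pose eta i : V := \row_l D i (z (inl l)).
have [freeB pP] := pBP m Mm.
have eta_b i l : (l < n.+1)%N -> dot (eta i) (grad (F l) m) = (l == i)%:R.
  move=> lt; have [derD Db] := DP i.
  have [_ DF] := pder_meval (F l) algA' derD (z := id) (fun l' => Az (inl l')).
  rewrite -Db // [D i (b l)]DF.
  by apply: eq_bigr => l' _; rewrite !mxE mulrC.
have orth i j : dot (row j (B m)) (eta i) = 0.
  have [derD _] := DP i.
  have [[x Xx px] p0 XG Tv] := pP j.
  pose w : V := \row_l D i (z (inr (j, l))).
  have Tw : conormal_tangent X (p m j) m (row_mx w (eta i)).
    move=> G XG'; pose zj a := row_mx (p a j) a : 'rV[K]_(N.+1 + N.+1).
    have Azj l : A' (fun t => zj t 0 l).
      rewrite -[l]splitK; case: (split l) => l' /=.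
        by under eq_fun do rewrite row_mxEl; exact: (Az (inr (j, l'))).
      by under eq_fun do rewrite row_mxEr; exact: (Az (inl l')).
    have [AG DG] := pder_meval G algA' derD Azj.
    have <- : \row_l D i (fun t => zj t 0 l) = row_mx w (eta i).
      apply/rowP => l; rewrite mxE -[l]splitK; case: (split l) => l' /=.
        rewrite row_mxEl mxE; congr (D i _).
        by apply/funext => t; rewrite row_mxEl.
      rewrite row_mxEr mxE; congr (D i _).
      by apply/funext => t; rewrite row_mxEr.
    rewrite -DG; apply: (pder0 derD) => // t M't.
    by have [_ /(_ j)[_ _ + _]] := pBP t (denseM'.1 t M't); apply.
  have := conormal_isotropic smooth Xx px p0 XG Tw Tv.
  rewrite !row_mxKl !row_mxKr dotC => ->.
  by rewrite /dot big1 // => l _; rewrite mxE mul0r.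
pose H := \matrix_(i < n.+1) eta i.
have rankH : \rank H = n.+1.
  apply/eqP; rewrite eqn_leq rank_leq_row /=.
  have : H *m (\matrix_(l < n.+1) grad (F l) m)^T = 1%:M.
    apply/matrixP => i l; rewrite !mxE eq_sym -val_eqE -(eta_b i l) //.
    by apply: eq_bigr => l' _; rewrite !mxE.
  move=> HG; rewrite -[X in (X <= _)%N](mxrank1 K) -HG; exact: mxrankM_maxl.
have : B m *m H^T = 0.
  apply/matrixP => j i; rewrite mxE [RHS]mxE -[RHS](orth i j).
  by apply: eq_bigr => l _; rewrite !mxE.
move=> /mulmx0_rank_max; rewrite mxrank_tr rankH (eqP freeB) addnS ltnS addnC.
by [].
Qed.

Theorem dual_stratum_dim X (r : int) :
  smooth_variety X -> dim_le (dual_stratum X r) (N%:Z - r - 1).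
Proof.
move=> smoothX n chain.
(* r may be negative; then k = 0 and the bound is the dimension of P^N. *)
pose k : nat := absz (Num.max (r + 1) 0).
suff : (n + k <= N)%N by lia.
apply: (irreducible_chain_bound smoothX _ chain) => h [_]; rewrite /k; lia.
Qed.
End ConesAndTangents.

Theorem theorem1p0p6 (R : realType) (N : nat) (X : set (proj_space R[i] N))
    (r : int) :
  smooth_variety X -> dim_le (dual_stratum X r) (N%:Z - r - 1).
Proof.
apply: dual_stratum_dim.
exact: pchar_num.
Qed.
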